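(* There is an absolute constant $c>0$ (independent of $r$, $n$, $\alpha$, $f$ and of the Favard operator) such that the following holds. Let $r,n$ be positive integers, let $A_{n,r}$ be a Favard operator with constant $F_r=\mathcal{K}_r$, and for a continuous $2\pi$-periodic function $f$ let $E^F_{n-1}(f)$ be the best uniform approximation of $f$ by $A_{n,r}$. Then for every continuous $2\pi$-periodic function $f$: (i) for all $\alpha\in(1,2n/r)$, $$E_{n-1}^F(f)\le c\,\max\left((\alpha-1)^{-2},1\right)\sqrt{r}\;2^{-r}\,\omega_r\left(f,\frac{\alpha\pi}{n}\right);$$ (ii) $$E_{n-1}^F(f)\le c\; r^{3/2}\,2^{-r}\,\omega_r\left(f,\frac{\pi}{n}\right).$$
   Context: $T=\mathbb{R}/(2\pi\mathbb{Z})$, $\|\cdot\|$ is the uniform (sup) norm over $T$, and $D^r$ is the $r$-th derivative. The modulus of continuity of order $r$ is $$\omega_r(f,\delta)=\sup_{|h|\le\delta}\ \sup_{x}|\Delta_h^r f(x)|,\qquad \Delta_h^r f(x)=\sum_{j=0}^{r}(-1)^j\binom{r}{j} f(x+jh).$$ The Favard constants are $$\mathcal{K}_r=\frac4\pi\sum_{j=-\infty}^{\infty}(4j+1)^{-r-1}.$$ A Favard operator with constant $F_r$ is an operator $A_{n,r}$ (mapping functions on $T$ to functions on $T$) such that $$\|g-A_{n,r}(g)\|\le F_r\,n^{-r}\,\|D^r g\|$$ for all $r$-times differentiable $2\pi$-periodic functions $g$ with bounded $r$-th derivative (for example, operators of approximation by periodic smooth splines, for which $F_r=\mathcal{K}_r$).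 The best uniform approximation of $f$ by the Favard operator is $$E^F_{n-1}(f)=\inf_{g}\|f-A_{n,r}(g)\|,$$ the infimum being taken over all functions $g$ in the domain of $A_{n,r}$. *)

(* Defs.v *)
(* Stdlib reals with Coquelicot. Functions on the circle R/(2 pi Z) are
   2 pi-periodic functions R -> R, so a supremum over the circle is a supremum
   over R. Norms, moduli and infima are Rbar-valued: no boundedness has to be
   assumed for them to be meaningful. *)
From Stdlib Require Import Reals.
From Coquelicot Require Import Coquelicot.
Open Scope R_scope.

Definition periodic (f : R -> R) : Prop :=
  forall x, f (x + 2 * PI) = f x.

Definition sup_norm (f : R -> R) : Rbar :=
  Lub_Rbar (fun y => exists x, y = Rabs (f x)).

(* [Binomial.C] is the real-valued binomial coefficient; unqualified [C] is
   Coquelicot's type of complex numbers. *)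
Definition fin_diff (r : nat) (h : R) (f : R -> R) (x : R) : R :=
  sum_f_R0 (fun j => (-1) ^ j * Binomial.C r j * f (x + INR j * h)) r.

Definition modulus (r : nat) (f : R -> R) (delta : R) : Rbar :=
  Lub_Rbar (fun y => exists h x,
    Rabs h <= delta /\ y = Rabs (fin_diff r h f x)).

(* The series over the integers is the limit of its symmetric partial sums:
   [i] in 0..2N stands for the index j = i - N in -N..N. It converges
   absolutely for r >= 1. *)
Definition favard_const (r : nat) : R :=
  4 / PI * real (Lim_seq (fun N =>
    sum_f_R0 (fun i => / (4 * (INR i - INR N) + 1) ^ (S r)) (2 * N))).

(* All orders k <= r are required: [Derive] is total, so [ex_derive_n g r x]
   alone does not say that the lower derivatives exist. *)
Definition bounded_derivative_class (r : nat) (g : R -> R) : Prop :=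
  periodic g /\
  (forall k x, (k <= r)%nat -> ex_derive_n g k x) /\
  (exists M, forall x, Rabs (Derive_n g r x) <= M).

(* The domain is part of the data; [fav_op] is total, but its values outside
   [fav_dom] are irrelevant. No linearity is assumed. *)
Record favard_operator (n r : nat) (F : R) : Type := FavardOperator {
  fav_dom : (R -> R) -> Prop;
  fav_op : (R -> R) -> R -> R;
  fav_dom_periodic : forall g, fav_dom g -> periodic g;
  fav_op_periodic : forall g, fav_dom g -> periodic (fav_op g);
  fav_dom_class : forall g, bounded_derivative_class r g -> fav_dom g;
  fav_bound : forall g, bounded_derivative_class r g ->
    Rbar_le (sup_norm (fun x => g x - fav_op g x))
            (Rbar_mult (F * / INR n ^ r) (sup_norm (Derive_n g r)))
}.

Arguments fav_dom {n r F}.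
Arguments fav_op {n r F}.

(* [Glb_Rbar] takes a set of reals, so functions at infinite distance are left
   out; this does not change the infimum, [Glb_Rbar] of the empty set being
   [p_infty]. *)
Definition best_approx {n r : nat} {F : R} (A : favard_operator n r F)
    (f : R -> R) : Rbar :=
  Glb_Rbar (fun y => exists g, fav_dom A g /\
    sup_norm (fun x => f x - fav_op A g x) = Finite y).

(* Main.v *)
Require Import Defs.
From Stdlib Require Import Reals Lra Lia ZArith Compare_dec.
From Coquelicot Require Import Coquelicot.
Open Scope R_scope.

(** Both bounds follow from [E <= c sqrt r 2^(-r) omega_r (f, PI / n)], because
    [omega_r (f, .)] is nondecreasing, [max ((alpha - 1)^(-2)) 1 >= 1] and
    [sqrt r <= r^(3/2)].

    A Favard operator is accurate on the trigonometric polynomials [g] of degree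
    [< n]: by [bernstein_nikolskii_stechkin], [|D^r g| <= (n/2)^r |Delta^r g|]
    with step [PI / n], so [|g - A g| <= K_r 2^(-r) omega_r (g, PI / n)], and
    [K_r <= 3]. As [omega_r g <= omega_r f + 2^r |f - g|], it remains to find such
    a [g] with [|f - g| <= c sqrt r 2^(-r) omega_r (f, PI / n)]: this is
    [jackson_stechkin]. By density [f] may be taken to be a trigonometric
    polynomial of arbitrary degree, and then everything is a matter of bounding,
    uniformly in that degree, Fourier multipliers [k |-> H k] for the uniform norm.

    All these bounds come from one fact, [cos_mixture_convex]: a nonnegative,
    nonincreasing and convex sequence on [0..K] is a mixture of the cosines
    [cos (k PI l / K)] with nonnegative weights (the weights of a tent are values
    of a Fejer kernel). A cosine acts as an average of two translations, so such a
    multiplier has norm at most [Y 0], even after it is shifted by half a period, which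
    turns the peak at [0] into one at [K].

    Since [omega_(r+1) <= 2 omega_r], the order may be taken even, [r = 2m]. The
    centred difference with step [t] is then the multiplier
    [(2 sin (k t / 2))^(2m)], up to sign. Two ranges of frequencies are removed
    from [f].

    - [k > 4n], in [high_frequency_bound]. The differences with [|t| <= PI / n]
      are averaged against a tent and divided by the central binomial coefficient,
      which is of order [4^m / sqrt m]. The result is [1 - u], where [u] collects
      the noncentral terms; it is [O (n^2 / k^2)] and has norm at most [1/2] on
      these frequencies. Hence the high part [y] of [f] satisfies
      [|y| <= c sqrt m 4^(-m) omega + |y| / 2].
    - [n <= k <= 8n], in [middle_frequency_bound]. A single step [t = PI / p] has
      [sin (k t / 2)] close to [1] as long as [|k - p| <= p / sqrt m], and there
      it can be inverted at bounded cost ([cosecant_multiplier]). Tents of width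
      about [n / sqrt m], centred at points [p >= n], form a partition of unity of
      the range; there are [O (sqrt m)] of them, whence the factor [sqrt r], and
      all the steps [PI / p] are at most [PI / n]. *)

(** * Finite sums *)

Lemma sum_scal (c : R) (u : nat -> R) (N : nat) :
  sum_f_R0 (fun i => c * u i) N = c * sum_f_R0 u N.
Proof. rewrite scal_sum. apply sum_eq. intros; ring. Qed.

Lemma cos_sin_INR_PI (l : nat) : cos (INR l * PI) = (-1) ^ l /\ sin (INR l * PI) = 0.
Proof.
  induction l as [|l [Hc Hs]].
  - simpl INR. rewrite Rmult_0_l, cos_0, sin_0. simpl; lra.
  - rewrite S_INR, Rmult_plus_distr_r, Rmult_1_l, neg_cos, neg_sin, Hc, Hs.
    simpl; split; ring.
Qed.

(** * Nonnegative cosine mixtures *)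

Lemma sum_cos_telescope (x phi : R) (N : nat) :
  2 * sin (x / 2) * sum_f_R0 (fun l => cos (INR l * x + phi)) N =
  sin ((INR N + / 2) * x + phi) - sin (phi - x / 2).
Proof.
  induction N as [|N IH].
  - simpl. rewrite Rmult_0_l, Rplus_0_l, Rplus_0_l.
    replace (/ 2 * x) with (x / 2) by field. rewrite sin_plus, sin_minus. ring.
  - rewrite tech5, Rmult_plus_distr_l, IH, S_INR.
    replace ((INR N + / 2) * x + phi) with ((INR N + 1) * x + phi - x / 2) by field.
    replace ((INR N + 1 + / 2) * x + phi) with ((INR N + 1) * x + phi + x / 2) by field.
    rewrite (sin_plus _ (x / 2)), (sin_minus ((INR N + 1) * x + phi)). ring.
Qed.

Definition node (K l : nat) : R := INR l * PI / INR K.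

(** Summation over the points [node K l], which run once around the circle; it is
    [2 * K] times the mean for every trigonometric polynomial of degree [< 2 * K]. *)
Definition node_sum (K : nat) (u : R -> R) : R :=
  sum_f_R0 (fun l => u (node K l)) (2 * K - 1).

Lemma node_sum_cos_phase (K i : nat) (phi : R) : (1 <= i <= 2 * K - 1)%nat ->
  node_sum K (fun s => cos (INR i * s + phi)) = 0.
Proof.
  intros Hi. unfold node_sum, node.
  assert (HK : 0 < INR K) by (apply lt_0_INR; lia).
  set (x := INR i * PI / INR K).
  assert (Hx : 0 < x / 2 < PI).
  { assert (0 < INR i) by (apply lt_0_INR; lia).
    assert (INR i < 2 * INR K).
    { replace 2 with (INR 2) by reflexivity. rewrite <- mult_INR. apply lt_INR; lia. }
    pose proof PI_RGT_0. unfold x. split.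
    - apply Rdiv_lt_0_compat; [|lra]. apply Rdiv_lt_0_compat; nra.
    - apply Rmult_lt_reg_r with (2 * INR K); [lra|].
      replace (INR i * PI / INR K / 2 * (2 * INR K)) with (INR i * PI) by (field; lra).
      nra. }
  assert (Hs : 0 < sin (x / 2)) by (apply sin_gt_0; lra).
  assert (E : sum_f_R0 (fun l => cos (INR i * (INR l * PI / INR K) + phi)) (2 * K - 1) =
              sum_f_R0 (fun l => cos (INR l * x + phi)) (2 * K - 1)).
  { apply sum_eq; intros l _. do 2 f_equal. unfold x. field. lra. }
  rewrite E.
  assert (T := sum_cos_telescope x phi (2 * K - 1)).
  assert (Z : sin ((INR (2 * K - 1) + / 2) * x + phi) = sin (phi - x / 2)).
  { rewrite minus_INR by lia. rewrite mult_INR. simpl INR.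
    replace (((1 + 1) * INR K - 1 + / 2) * x + phi) with (phi - x / 2 + 2 * INR i * PI)
      by (unfold x; field; lra).
    apply sin_period. }
  rewrite Z in T. nra.
Qed.

Lemma node_sum_ext (K : nat) (u v : R -> R) :
  (forall s, u s = v s) -> node_sum K u = node_sum K v.
Proof. intros E. apply sum_eq; intros; apply E. Qed.

Lemma node_sum_cos (K i : nat) : (1 <= i <= 2 * K - 1)%nat ->
  node_sum K (fun s => cos (INR i * s)) = 0.
Proof.
  intros Hi. rewrite <- (node_sum_cos_phase K i 0 Hi).
  apply node_sum_ext. intros s. rewrite Rplus_0_r. reflexivity.
Qed.

Lemma node_sum_one (K : nat) : (1 <= K)%nat -> node_sum K (fun _ => 1) = 2 * INR K.
Proof.
  intros HK. unfold node_sum. rewrite sum_cte.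
  replace (S (2 * K - 1)) with (2 * K)%nat by lia. rewrite mult_INR. simpl INR. ring.
Qed.

Lemma node_sum_plus (K : nat) (u v : R -> R) :
  node_sum K (fun s => u s + v s) = node_sum K u + node_sum K v.
Proof. apply plus_sum. Qed.

Lemma node_sum_cos_cos (K i k : nat) : (1 <= i <= K - 1)%nat -> (k <= K)%nat ->
  node_sum K (fun s => 2 * cos (INR i * s) * cos (INR k * s)) =
  if Nat.eq_dec i k then 2 * INR K else 0.
Proof.
  intros Hi Hk.
  assert (E : node_sum K (fun s => 2 * cos (INR i * s) * cos (INR k * s)) =
    node_sum K (fun s => cos (INR (i + k) * s)) +
    node_sum K (fun s => cos ((INR i - INR k) * s))).
  { rewrite <- node_sum_plus. apply node_sum_ext; intros s.
    rewrite plus_INR, Rmult_plus_distr_r, Rmult_minus_distr_r, cos_plus, cos_minus. ring. }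
  rewrite E, node_sum_cos by lia. destruct (Nat.eq_dec i k) as [->|Hne].
  - rewrite (node_sum_ext _ _ (fun _ => 1)).
    + rewrite node_sum_one by lia. ring.
    + intros s. rewrite Rminus_diag, Rmult_0_l. apply cos_0.
  - destruct (Nat.lt_ge_cases k i) as [Hlt|Hge].
    + rewrite <- minus_INR by lia. rewrite node_sum_cos by lia. ring.
    + rewrite (node_sum_ext _ _ (fun s => cos (INR (k - i) * s))).
      * rewrite node_sum_cos by lia. ring.
      * intros s. rewrite minus_INR by lia. rewrite <- (cos_neg ((INR k - INR i) * s)).
        f_equal. ring.
Qed.

(** The kernels are not normalised: [fejer p] has mean [p]. *)
Fixpoint dirichlet (q : nat) (s : R) : R :=
  match q with
  | O => 1
  | S q' => dirichlet q' s + 2 * cos (INR (S q') * s)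
  end.

Fixpoint fejer (p : nat) (s : R) : R :=
  match p with
  | O => 0
  | S q => fejer q s + dirichlet q s
  end.

(** Multiplication by [sin (s / 2)] makes the sum of cosines telescope; applied
    twice, it shows that the Fejer kernel is a quotient of squares. *)
Lemma dirichlet_sin (q : nat) (s : R) :
  dirichlet q s * sin (s / 2) = sin ((2 * INR q + 1) * (s / 2)).
Proof.
  induction q as [|q IH].
  - simpl. rewrite Rmult_1_l. f_equal. ring.
  - change (dirichlet (S q) s) with (dirichlet q s + 2 * cos (INR (S q) * s)).
    rewrite Rmult_plus_distr_r, IH, S_INR.
    replace ((2 * INR q + 1) * (s / 2)) with ((INR q + 1) * s - s / 2) by field.
    replace ((2 * (INR q + 1) + 1) * (s / 2)) with ((INR q + 1) * s + s / 2) by field.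
    rewrite sin_plus, sin_minus. ring.
Qed.

Lemma fejer_sin (p : nat) (s : R) :
  fejer p s * sin (s / 2) ^ 2 = sin (INR p * (s / 2)) ^ 2.
Proof.
  induction p as [|p IH].
  - simpl. rewrite (Rmult_0_l (s / 2)), sin_0. ring.
  - simpl fejer. rewrite Rmult_plus_distr_r, IH.
    replace (dirichlet p s * sin (s / 2) ^ 2)
      with (dirichlet p s * sin (s / 2) * sin (s / 2)) by ring.
    rewrite dirichlet_sin, S_INR.
    replace ((2 * INR p + 1) * (s / 2)) with (2 * (INR p * (s / 2)) + s / 2) by ring.
    rewrite Rmult_plus_distr_r, Rmult_1_l, !sin_plus, sin_2a, cos_2a_sin.
    assert (C1 := sin2_cos2 (INR p * (s / 2))). assert (C2 := sin2_cos2 (s / 2)).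
    unfold Rsqr in *.
    set (X := sin (INR p * (s / 2))) in *. set (Y := cos (INR p * (s / 2))) in *.
    set (u := sin (s / 2)) in *. set (v := cos (s / 2)) in *.
    replace ((X * v + Y * u) ^ 2) with (X * X * (v * v) + 2 * X * Y * u * v + Y * Y * (u * u)) by ring.
    replace (Y * Y) with (1 - X * X) by lra. replace (v * v) with (1 - u * u) by lra. ring.
Qed.

Lemma fejer_nonneg (p : nat) (s : R) : 0 <= fejer p s.
Proof.
  destruct (Req_dec (sin (s / 2)) 0) as [Z|NZ].
  - assert (D : forall i, cos (INR i * s) = 1).
    { assert (C : cos s = 1).
      { replace s with (2 * (s / 2)) by field. rewrite cos_2a_sin, Z. ring. }
      assert (Sn : sin s = 0).
      { replace s with (2 * (s / 2)) by field. rewrite sin_2a, Z. ring. }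
      induction i as [|i IH].
      - simpl. rewrite Rmult_0_l. apply cos_0.
      - rewrite S_INR, Rmult_plus_distr_r, Rmult_1_l, cos_plus, C, Sn, IH. ring. }
    assert (P : forall q, 1 <= dirichlet q s).
    { induction q as [|q IH]; [simpl; lra|].
      change (1 <= dirichlet q s + 2 * cos (INR (S q) * s)). rewrite D. lra. }
    induction p as [|p IH]; simpl; [lra|]. specialize (P p). lra.
  - assert (H := fejer_sin p s).
    assert (0 < sin (s / 2) ^ 2) by (apply pow2_gt_0; exact NZ).
    assert (0 <= sin (INR p * (s / 2)) ^ 2) by apply pow2_ge_0. nra.
Qed.

(** The node sums are the discrete Fourier coefficients, so the kernel [dirichlet q]
    represents the indicator of [0..q] and, summing over [q < p], the kernel
    [fejer p] represents the tent [p - k]. *)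
Lemma node_sum_dirichlet (K q k : nat) : (q < K)%nat -> (k <= K)%nat ->
  node_sum K (fun s => dirichlet q s * cos (INR k * s)) =
  2 * INR K * (if le_dec k q then 1 else 0).
Proof.
  intros Hq Hk. induction q as [|q IH].
  - rewrite (node_sum_ext _ _ (fun s => cos (INR k * s))) by (intros; simpl; ring).
    destruct k as [|k].
    + rewrite (node_sum_ext _ _ (fun _ => 1)).
      * rewrite node_sum_one by lia. destruct (le_dec 0 0); [ring|lia].
      * intros s. simpl. rewrite Rmult_0_l. apply cos_0.
    + rewrite node_sum_cos by lia. destruct (le_dec (S k) 0); [lia|ring].
  - rewrite (node_sum_ext _ _ (fun s => dirichlet q s * cos (INR k * s) +
      2 * cos (INR (S q) * s) * cos (INR k * s)))
      by (intros s; change (dirichlet (S q) s) with (dirichlet q s + 2 * cos (INR (S q) * s)); ring).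
    rewrite node_sum_plus, IH, node_sum_cos_cos by lia.
    destruct (Nat.eq_dec (S q) k), (le_dec k q), (le_dec k (S q)); try lia; ring.
Qed.

Lemma node_sum_fejer (K p k : nat) : (p <= K)%nat -> (k <= K)%nat ->
  node_sum K (fun s => fejer p s * cos (INR k * s)) = 2 * INR K * INR (p - k).
Proof.
  intros Hp Hk. induction p as [|p IH].
  - rewrite (node_sum_ext _ _ (fun _ => 0 * 1)) by (intros; simpl; ring).
    unfold node_sum. rewrite sum_scal. simpl INR. ring.
  - rewrite (node_sum_ext _ _ (fun s => fejer p s * cos (INR k * s) +
      dirichlet p s * cos (INR k * s))) by (intros; simpl fejer; ring).
    rewrite node_sum_plus, IH, node_sum_dirichlet by lia.
    destruct (le_dec k p) as [L|L].
    + rewrite Nat.sub_succ_l, S_INR by lia. ring.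
    + replace (S p - k)%nat with O by lia. replace (p - k)%nat with O by lia. simpl; ring.
Qed.

(** The frequencies are restricted to the grid [node K l] so that a mixture is
    [2 * K]-periodic and even, and weights can be added index by index. *)
Definition cos_mixture (K : nat) (Y : nat -> R) : Prop :=
  exists c : nat -> R, (forall l, 0 <= c l) /\
    forall k, (k <= K)%nat ->
      Y k = sum_f_R0 (fun l => c l * cos (INR k * node K l)) (2 * K - 1).

Lemma cos_mixture_ext (K : nat) (Y Z : nat -> R) :
  (forall k, (k <= K)%nat -> Y k = Z k) -> cos_mixture K Y -> cos_mixture K Z.
Proof.
  intros E [c [Hc H]]. exists c. split; [exact Hc|].
  intros k Hk. rewrite <- E by exact Hk. auto.
Qed.

Lemma cos_mixture_lin (K : nat) (Y Z : nat -> R) (d : R) : 0 <= d ->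
  cos_mixture K Y -> cos_mixture K Z -> cos_mixture K (fun k => Y k + d * Z k).
Proof.
  intros Hd [c [Hc H]] [e [He H']]. exists (fun l => c l + d * e l). split.
  - intros l. specialize (Hc l). specialize (He l). nra.
  - intros k Hk. rewrite H, H' by exact Hk. rewrite <- sum_scal, <- plus_sum.
    apply sum_eq; intros; ring.
Qed.

Lemma cos_mixture_const (K : nat) (d : R) : 0 <= d -> cos_mixture K (fun _ => d).
Proof.
  intros Hd. exists (fun l => if Nat.eq_dec l 0 then d else 0). split.
  - intros l. destruct (Nat.eq_dec l 0); lra.
  - intros k _. induction (2 * K - 1)%nat as [|N IH].
    + simpl. unfold node. simpl. unfold Rdiv. rewrite !Rmult_0_l, Rmult_0_r, cos_0. ring.
    + rewrite tech5, <- IH. destruct (Nat.eq_dec (S N) 0); [lia|ring].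
Qed.

Lemma cos_mixture_tent (K p : nat) : (1 <= K)%nat -> (p <= K)%nat ->
  cos_mixture K (fun k => INR (p - k)).
Proof.
  intros HK Hp. assert (0 < INR K) by (apply lt_0_INR; lia).
  exists (fun l => / (2 * INR K) * fejer p (node K l)). split.
  - intros l. apply Rmult_le_pos; [|apply fejer_nonneg].
    left. apply Rinv_0_lt_compat. lra.
  - intros k Hk.
    rewrite (sum_eq _ (fun l => / (2 * INR K) *
      (fejer p (node K l) * cos (INR k * node K l)))) by (intros; ring).
    rewrite sum_scal.
    change (INR (p - k) = / (2 * INR K) * node_sum K (fun s => fejer p s * cos (INR k * s))).
    rewrite node_sum_fejer by assumption. field. lra.
Qed.

Definition convex_decreasing (K : nat) (Y : nat -> R) : Prop :=
  (forall i, (i <= K)%nat -> 0 <= Y i) /\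
  (forall i, (S i <= K)%nat -> Y (S i) <= Y i) /\
  (forall i, (S (S i) <= K)%nat -> Y (S i) - Y (S (S i)) <= Y i - Y (S i)).

(** A convex nonincreasing sequence is a constant plus a nonnegative combination of
    tents, and tents are mixtures because Fejer kernels are nonnegative. The
    induction is on the point [j] from which the sequence is constant: subtracting
    the tent with corner [j + 1] and slope [Z j - Z (j + 1)] flattens the last
    sloping piece and keeps the convexity. *)
Lemma cos_mixture_convex (K : nat) (Y : nat -> R) : (1 <= K)%nat ->
  convex_decreasing K Y -> cos_mixture K Y.
Proof.
  intros HK [H3 [H1 H2]].
  assert (G : forall j Z, (j <= K)%nat ->
    (forall i, (S i <= K)%nat -> Z (S i) <= Z i) ->
    (forall i, (S (S i) <= K)%nat -> Z (S i) - Z (S (S i)) <= Z i - Z (S i)) ->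
    0 <= Z K -> (forall i, (j <= i <= K)%nat -> Z i = Z K) -> cos_mixture K Z).
  { induction j as [|j IH]; intros Z Hj Hdec Hcvx Hpos Hcst.
    - apply cos_mixture_ext with (fun _ => Z K); [|apply cos_mixture_const; exact Hpos].
      intros k Hk. symmetry. apply Hcst. lia.
    - set (d := Z j - Z (S j)).
      assert (Hd : 0 <= d) by (unfold d; specialize (Hdec j Hj); lra).
      assert (Hall : forall e i, (j = i + e)%nat -> d <= Z i - Z (S i)).
      { induction e as [|e IHe]; intros i Hi.
        - replace i with j by lia. unfold d. lra.
        - assert (A := IHe (S i) ltac:(lia)). assert (B := Hcvx i ltac:(lia)). lra. }
      apply cos_mixture_ext with
        (fun k => (Z k - d * INR (S j - k)) + d * INR (S j - k)); [intros; ring|].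
      apply cos_mixture_lin; [exact Hd| |apply cos_mixture_tent; lia].
      assert (T1 : forall i, (i <= j)%nat -> INR (S j - i) = INR (S j - S i) + 1).
      { intros i Hi. replace (S j - i)%nat with (S (S j - S i)) by lia. apply S_INR. }
      assert (T0 : forall i, (S j <= i)%nat -> INR (S j - i) = 0).
      { intros i Hi. replace (S j - i)%nat with O by lia. reflexivity. }
      apply IH; [lia| | | |].
      + intros i Hi. destruct (Nat.le_gt_cases i j) as [L|L].
        * rewrite (T1 i L). assert (A := Hall (j - i)%nat i ltac:(lia)). nra.
        * rewrite !T0 by lia. specialize (Hdec i Hi). lra.
      + intros i Hi. destruct (Nat.le_gt_cases (S i) j) as [L|L].
        * rewrite (T1 i ltac:(lia)), (T1 (S i) L). specialize (Hcvx i Hi). nra.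
        * rewrite (T0 (S i)), (T0 (S (S i))) by lia.
          rewrite (Hcst (S i)), (Hcst (S (S i))) by lia.
          destruct (Nat.eq_dec i j) as [->|Ne].
          -- rewrite Nat.sub_succ_l, Nat.sub_diag by lia. simpl INR. unfold d.
             rewrite (Hcst (S j)) by lia. lra.
          -- rewrite T0 by lia. rewrite (Hcst i) by lia. lra.
      + rewrite T0 by lia. lra.
      + intros i Hi. rewrite (T0 K) by lia. destruct (Nat.eq_dec i j) as [->|Ne].
        * rewrite Nat.sub_succ_l, Nat.sub_diag by lia. simpl INR. unfold d.
          rewrite (Hcst (S j)) by lia. lra.
        * rewrite T0 by lia. rewrite (Hcst i) by lia. lra. }
  apply (G K Y); auto. intros i Hi. f_equal. lia.
Qed.

(** * Norms of Fourier multipliers *)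

(** A trigonometric polynomial with fixed coefficients [a], [b] and variable weights
    [G]: multipliers act on [G]. The phase [psi] absorbs the quarter turns produced
    by derivatives and by differences of odd order. *)
Definition tpoly (a b : nat -> R) (D : nat) (psi : R) (G : nat -> R) (x : R) : R :=
  sum_f_R0 (fun k => G k * (a k * cos (INR k * x + psi) + b k * sin (INR k * x + psi))) D.

Lemma tpoly_ext (a b : nat -> R) (D : nat) (psi : R) (G H : nat -> R) (x : R) :
  (forall k, (k <= D)%nat -> G k = H k) -> tpoly a b D psi G x = tpoly a b D psi H x.
Proof. intros E. apply sum_eq. intros k Hk. rewrite E by exact Hk. reflexivity. Qed.

Lemma tpoly_plus (a b : nat -> R) (D : nat) (psi : R) (G H : nat -> R) (x : R) :
  tpoly a b D psi (fun k => G k + H k) x = tpoly a b D psi G x + tpoly a b D psi H x.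
Proof. unfold tpoly. rewrite <- plus_sum. apply sum_eq. intros; ring. Qed.

Lemma tpoly_scal (a b : nat -> R) (D : nat) (psi c : R) (G : nat -> R) (x : R) :
  tpoly a b D psi (fun k => c * G k) x = c * tpoly a b D psi G x.
Proof. unfold tpoly. rewrite <- sum_scal. apply sum_eq. intros; ring. Qed.

(** The operator norm of the multiplier [H] on polynomials of degree at most [D]
    is at most [C]. *)
Definition multiplier_le (D : nat) (H : nat -> R) (C : R) : Prop :=
  forall a b psi G B,
    (forall x, Rabs (tpoly a b D psi G x) <= B) ->
    forall x, Rabs (tpoly a b D psi (fun k => H k * G k) x) <= C * B.

Lemma multiplier_le_ext (D : nat) (H H' : nat -> R) (C : R) :
  (forall k, (k <= D)%nat -> H k = H' k) -> multiplier_le D H C -> multiplier_le D H' C.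
Proof.
  intros E M a b psi G B HB x.
  rewrite (tpoly_ext _ _ _ _ _ (fun k => H k * G k)); [apply M; exact HB|].
  intros k Hk. rewrite E by exact Hk. reflexivity.
Qed.

Lemma multiplier_le_weaken (D : nat) (H : nat -> R) (C C' : R) :
  C <= C' -> multiplier_le D H C -> multiplier_le D H C'.
Proof.
  intros HC M a b psi G B HB x. apply Rle_trans with (C * B); [apply M; exact HB|].
  apply Rmult_le_compat_r; [|exact HC].
  apply Rle_trans with (1 := Rabs_pos _) (2 := HB 0).
Qed.

(** [cos (k t)] is the mean of the translations by [t] and [- t]. *)
Lemma multiplier_le_cos (D : nat) (t : R) : multiplier_le D (fun k => cos (INR k * t)) 1.
Proof.
  intros a b psi G B HB x.
  replace (tpoly a b D psi (fun k => cos (INR k * t) * G k) x)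
    with (/ 2 * (tpoly a b D psi G (x + t) + tpoly a b D psi G (x - t))).
  - rewrite Rabs_mult, (Rabs_pos_eq (/ 2)) by lra.
    pose proof (Rabs_triang (tpoly a b D psi G (x + t)) (tpoly a b D psi G (x - t))).
    pose proof (HB (x + t)). pose proof (HB (x - t)). lra.
  - unfold tpoly. rewrite <- plus_sum, <- sum_scal. apply sum_eq. intros k _.
    replace (INR k * (x + t) + psi) with (INR k * x + psi + INR k * t) by ring.
    replace (INR k * (x - t) + psi) with (INR k * x + psi - INR k * t) by ring.
    generalize (INR k * x + psi); intros y.
    rewrite cos_plus, cos_minus, sin_plus, sin_minus. field.
Qed.

Lemma multiplier_le_one (D : nat) : multiplier_le D (fun _ => 1) 1.
Proof.
  apply multiplier_le_ext with (fun k => cos (INR k * 0)); [|apply multiplier_le_cos].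
  intros. rewrite Rmult_0_r. apply cos_0.
Qed.

Lemma multiplier_le_plus (D : nat) (H1 H2 : nat -> R) (C1 C2 : R) :
  multiplier_le D H1 C1 -> multiplier_le D H2 C2 ->
  multiplier_le D (fun k => H1 k + H2 k) (C1 + C2).
Proof.
  intros M1 M2 a b psi G B HB x.
  rewrite (tpoly_ext _ _ _ _ _ (fun k => H1 k * G k + H2 k * G k)) by (intros; ring).
  rewrite tpoly_plus. eapply Rle_trans; [apply Rabs_triang|].
  rewrite Rmult_plus_distr_r. apply Rplus_le_compat; auto.
Qed.

Lemma multiplier_le_scal (D : nat) (c : R) (H : nat -> R) (C : R) :
  multiplier_le D H C -> multiplier_le D (fun k => c * H k) (Rabs c * C).
Proof.
  intros M a b psi G B HB x.
  rewrite (tpoly_ext _ _ _ _ _ (fun k => c * (H k * G k))) by (intros; ring).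
  rewrite tpoly_scal, Rabs_mult, Rmult_assoc.
  apply Rmult_le_compat_l; [apply Rabs_pos|]. apply M; exact HB.
Qed.

Lemma multiplier_le_mult (D : nat) (H1 H2 : nat -> R) (C1 C2 : R) :
  multiplier_le D H1 C1 -> multiplier_le D H2 C2 ->
  multiplier_le D (fun k => H1 k * H2 k) (C1 * C2).
Proof.
  intros M1 M2 a b psi G B HB x.
  rewrite (tpoly_ext _ _ _ _ _ (fun k => H1 k * (H2 k * G k))) by (intros; ring).
  rewrite Rmult_assoc. apply M1. intros y. apply M2. exact HB.
Qed.

Lemma multiplier_le_pow (D : nat) (H : nat -> R) (C : R) (p : nat) :
  multiplier_le D H C -> multiplier_le D (fun k => H k ^ p) (C ^ p).
Proof.
  intros M. induction p as [|p IH]; simpl.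
  - apply multiplier_le_one.
  - apply multiplier_le_mult; assumption.
Qed.

Lemma multiplier_le_sum (D : nat) (H : nat -> nat -> R) (C : nat -> R) (N : nat) :
  (forall l, (l <= N)%nat -> multiplier_le D (H l) (C l)) ->
  multiplier_le D (fun k => sum_f_R0 (fun l => H l k) N) (sum_f_R0 C N).
Proof.
  induction N as [|N IH]; intros M; simpl.
  - apply M; lia.
  - apply multiplier_le_plus; [apply IH; intros; apply M; lia|apply M; lia].
Qed.

(** The signs or modulations [e l] cost no more than their maximum, since the
    weights [c l] are nonnegative. *)
Lemma multiplier_le_mixture (D N : nat) (c e t : nat -> R) (E : R) :
  (forall l, 0 <= c l) -> (forall l, Rabs (e l) <= E) ->
  multiplier_le D (fun k => sum_f_R0 (fun l => c l * e l * cos (INR k * t l)) N)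
    (E * sum_f_R0 c N).
Proof.
  intros Hc He.
  apply multiplier_le_weaken with (sum_f_R0 (fun l => Rabs (c l * e l) * 1) N).
  - rewrite <- sum_scal. apply sum_Rle. intros l _.
    rewrite Rabs_mult, (Rabs_pos_eq (c l)) by apply Hc.
    specialize (He l). specialize (Hc l). nra.
  - apply (multiplier_le_sum D (fun l k => c l * e l * cos (INR k * t l))).
    intros l _. apply multiplier_le_scal. apply multiplier_le_cos.
Qed.

Lemma mixture_total (K : nat) (c : nat -> R) (N : nat) :
  sum_f_R0 (fun l => c l * cos (INR 0 * node K l)) N = sum_f_R0 c N.
Proof. apply sum_eq. intros l _. simpl INR. rewrite Rmult_0_l, cos_0. ring. Qed.

Lemma convex_multiplier (K D : nat) (Y : nat -> R) : (D <= K)%nat ->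
  cos_mixture K Y -> multiplier_le D Y (Y O).
Proof.
  intros HD [c [Hc H]].
  assert (M := multiplier_le_mixture D (2 * K - 1) c (fun _ => 1) (node K) 1 Hc
    (fun _ => Req_le _ _ Rabs_R1)).
  rewrite (H O) by lia. rewrite mixture_total, <- (Rmult_1_l (sum_f_R0 c _)).
  apply multiplier_le_ext with (2 := M). intros k Hk. rewrite H by lia.
  apply sum_eq; intros; ring.
Qed.

(** Shifting a mixture by half its period [2 * K] multiplies its weights by
    [(-1)^l], so the peak moves from [0] to [K] at the same norm. The dilation by
    [q] lets a profile of period [2 * K / q], which need not be an integer, be
    repeated along the frequencies. *)
Lemma periodic_multiplier (K : nat) (Y : nat -> R) : (1 <= K)%nat -> cos_mixture K Y ->
  exists M : nat -> R,
    (forall j, (j <= K)%nat -> M j = Y (K - j)%nat) /\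
    (forall p j, M (2 * K * p + j)%nat = M j) /\
    (forall p j, (j <= 2 * K * p)%nat -> M (2 * K * p - j)%nat = M j) /\
    (forall D q, multiplier_le D (fun k => M (q * k)%nat) (Y O)).
Proof.
  intros HK [c [Hc H]].
  assert (K0 : 0 < INR K) by (apply lt_0_INR; lia).
  assert (P : forall p l, INR (2 * K * p) * node K l = 0 + 2 * INR (p * l) * PI).
  { intros p l. unfold node. rewrite !mult_INR. simpl (INR 2). field. lra. }
  exists (fun k => sum_f_R0 (fun l => c l * (-1) ^ l * cos (INR k * node K l)) (2 * K - 1)).
  repeat split.
  - intros j Hj. rewrite H by lia. apply sum_eq. intros l _.
    rewrite minus_INR by lia. rewrite Rmult_minus_distr_r.
    replace (INR K * node K l) with (INR l * PI) by (unfold node; field; lra).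
    destruct (cos_sin_INR_PI l) as [C S]. rewrite cos_minus, C, S. ring.
  - intros p j. apply sum_eq. intros l _. f_equal.
    rewrite plus_INR, Rmult_plus_distr_r, P.
    rewrite <- (cos_period (INR j * node K l) (p * l)). f_equal. ring.
  - intros p j Hj. apply sum_eq. intros l _. f_equal.
    rewrite minus_INR, Rmult_minus_distr_r, P by exact Hj.
    rewrite <- (cos_neg (INR j * node K l)).
    rewrite <- (cos_period (- (INR j * node K l)) (p * l)). f_equal. ring.
  - intros D q. rewrite (H O) by lia. rewrite mixture_total.
    rewrite <- (Rmult_1_l (sum_f_R0 c _)).
    apply multiplier_le_ext with (fun k => sum_f_R0
      (fun l => c l * (-1) ^ l * cos (INR k * (INR q * node K l))) (2 * K - 1)).
    + intros k _. apply sum_eq. intros l _. rewrite mult_INR. f_equal. f_equal. ring.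
    + apply multiplier_le_mixture; [exact Hc|]. intros l. rewrite pow_1_abs. lra.
Qed.

(** A tent centred at [p] is the central tent modulated by [2 cos (p s)], which
    also creates the mirror image at [- p]; for [w <= p] that image vanishes at
    the frequencies [k >= 0]. *)
Lemma tent_multiplier (D w p : nat) : (1 <= w <= p)%nat ->
  multiplier_le D (fun k => INR (w - (k - p) - (p - k))) (2 * INR w).
Proof.
  intros Hw. set (K := (D + p)%nat).
  destruct (cos_mixture_tent K w) as [c [Hc H]]; [unfold K; lia|unfold K; lia|].
  assert (T := H O ltac:(lia)). rewrite mixture_total, Nat.sub_0_r in T. rewrite T.
  apply multiplier_le_ext with (fun k => sum_f_R0
    (fun l => c l * (2 * cos (INR p * node K l)) * cos (INR k * node K l)) (2 * K - 1)).
  - intros k Hk.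
    assert (Z : sum_f_R0 (fun l => c l * cos (INR (k + p) * node K l)) (2 * K - 1) = 0).
    { rewrite <- H by (unfold K; lia). replace (w - (k + p))%nat with O by lia. reflexivity. }
    assert (S : sum_f_R0 (fun l => c l * cos ((INR k - INR p) * node K l)) (2 * K - 1) =
      INR (w - (k - p) - (p - k))).
    { destruct (Nat.le_gt_cases p k) as [L|L].
      - replace (w - (k - p) - (p - k))%nat with (w - (k - p))%nat by lia.
        rewrite H by (unfold K; lia). rewrite minus_INR by exact L. reflexivity.
      - replace (w - (k - p) - (p - k))%nat with (w - (p - k))%nat by lia.
        rewrite H by (unfold K; lia). rewrite minus_INR by lia.
        apply sum_eq. intros l _. rewrite <- cos_neg. f_equal. f_equal. ring. }
    rewrite <- S, <- (Rplus_0_l (sum_f_R0 (fun l => c l * cos ((INR k - INR p) * _)) _)), <- Z,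
      <- plus_sum.
    apply sum_eq. intros l _.
    rewrite plus_INR, Rmult_plus_distr_r, Rmult_minus_distr_r, cos_plus, cos_minus. ring.
  - apply multiplier_le_mixture; [exact Hc|]. intros l.
    rewrite Rabs_mult, Rabs_pos_eq by lra.
    assert (A : Rabs (cos (INR p * node K l)) <= 1).
    { apply Rabs_le. apply COS_bound. }
    lra.
Qed.

(** * The Bernstein-Nikolskii-Stechkin inequality *)

Lemma derive_nonneg_le (f df : R -> R) (x y : R) : x <= y ->
  (forall z, x <= z <= y -> is_derive f z (df z)) ->
  (forall z, x <= z <= y -> 0 <= df z) -> f x <= f y.
Proof.
  intros Hxy Hd Hp.
  destruct (MVT_gen f x y df) as [c [Hc E]];
    rewrite ?Rmin_left, ?Rmax_right in * by exact Hxy.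
  - intros z Hz. apply Hd. lra.
  - intros z Hz. apply derivable_continuous_pt. exists (df z).
    apply is_derive_Reals. apply Hd. exact Hz.
  - specialize (Hp c Hc). nra.
Qed.

Lemma Rmult_cos_le_sin (x : R) : 0 <= x <= PI -> x * cos x <= sin x.
Proof.
  intros Hx.
  assert (H : sin 0 - 0 * cos 0 <= sin x - x * cos x); [|rewrite sin_0 in H; lra].
  apply (derive_nonneg_le (fun y => sin y - y * cos y) (fun y => y * sin y)); [lra| |].
  - intros z _. auto_derive; [exact I|]. ring.
  - intros z Hz. apply Rmult_le_pos; [lra|]. apply sin_ge_0; lra.
Qed.

Lemma sin_2_cos_le (x : R) : 0 <= x <= PI ->
  2 * sin x * cos x <= x * (1 + cos x ^ 2).
Proof.
  intros Hx.
  assert (H : 0 * (1 + cos 0 ^ 2) - 2 * sin 0 * cos 0 <=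
              x * (1 + cos x ^ 2) - 2 * sin x * cos x); [|rewrite sin_0 in H; lra].
  apply (derive_nonneg_le (fun y => y * (1 + cos y ^ 2) - 2 * sin y * cos y)
    (fun y => sin y * (3 * sin y - 2 * (y * cos y)))); [lra| |].
  - intros z _. auto_derive; [exact I|].
    assert (C := sin2_cos2 z). unfold Rsqr in C.
    replace (sin z * (3 * sin z - 2 * (z * cos z)))
      with ((sin z * sin z + cos z * cos z) + 2 * sin z * sin z - cos z ^ 2
            - 2 * z * sin z * cos z) by ring.
    rewrite C. ring.
  - intros z Hz. assert (0 <= sin z) by (apply sin_ge_0; lra).
    assert (z * cos z <= sin z) by (apply Rmult_cos_le_sin; lra).
    apply Rmult_le_pos; lra.
Qed.

Definition sinc_inv (x : R) : R := x / sin x.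
Definition sinc_inv' (x : R) : R := (sin x - x * cos x) / sin x ^ 2.

Lemma is_derive_sinc_inv (x : R) : 0 < x < PI -> is_derive sinc_inv x (sinc_inv' x).
Proof.
  intros Hx. assert (0 < sin x) by (apply sin_gt_0; lra).
  unfold sinc_inv, sinc_inv'. auto_derive; [lra|]. field. lra.
Qed.

Lemma sinc_inv'_nonneg (x : R) : 0 < x < PI -> 0 <= sinc_inv' x.
Proof.
  intros Hx. assert (0 < sin x) by (apply sin_gt_0; lra).
  apply Rdiv_le_0_compat; [|apply pow_lt; lra].
  assert (x * cos x <= sin x) by (apply Rmult_cos_le_sin; lra). lra.
Qed.

Lemma sinc_inv'_incr (x y : R) : 0 < x -> x <= y -> y < PI -> sinc_inv' x <= sinc_inv' y.
Proof.
  intros Hx Hxy Hy.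
  apply derive_nonneg_le with
    (fun z => (z * (1 + cos z ^ 2) - 2 * sin z * cos z) / sin z ^ 3); [exact Hxy| |].
  - intros z Hz. assert (0 < sin z) by (apply sin_gt_0; lra).
    unfold sinc_inv'. auto_derive; [change (sin z ^ 2 <> 0); apply pow_nonzero; lra|].
    assert (C := sin2_cos2 z). unfold Rsqr in C.
    replace (1 + cos z ^ 2) with (sin z * sin z + 2 * cos z ^ 2) by (rewrite <- C; ring).
    field. lra.
  - intros z Hz. assert (0 < sin z) by (apply sin_gt_0; lra).
    assert (2 * sin z * cos z <= z * (1 + cos z ^ 2)) by (apply sin_2_cos_le; lra).
    apply Rdiv_le_0_compat; [lra|apply pow_lt; lra].
Qed.

Lemma sinc_inv_incr (x y : R) : 0 < x -> x <= y -> y < PI -> sinc_inv x <= sinc_inv y.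
Proof.
  intros Hx Hxy Hy. apply derive_nonneg_le with sinc_inv'; [exact Hxy| |].
  - intros z Hz. apply is_derive_sinc_inv. lra.
  - intros z Hz. apply sinc_inv'_nonneg. lra.
Qed.

Lemma sinc_inv_convex (y e : R) : 0 <= e -> 0 < y - e -> y + e < PI ->
  2 * sinc_inv y <= sinc_inv (y - e) + sinc_inv (y + e).
Proof.
  intros He H1 H2.
  assert (H : sinc_inv (y - 0) + sinc_inv (y + 0) <= sinc_inv (y - e) + sinc_inv (y + e)).
  { apply (derive_nonneg_le (fun z => sinc_inv (y - z) + sinc_inv (y + z))
      (fun z => - sinc_inv' (y - z) + sinc_inv' (y + z))); [exact He| |].
    - intros z Hz.
      assert (D1 := is_derive_sinc_inv (y - z) ltac:(lra)).
      assert (D2 := is_derive_sinc_inv (y + z) ltac:(lra)).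
      apply (is_derive_plus (fun z => sinc_inv (y - z)) (fun z => sinc_inv (y + z))).
      + replace (- sinc_inv' (y - z)) with (scal (-1) (sinc_inv' (y - z)))
          by (unfold scal; simpl; unfold mult; simpl; ring).
        apply (is_derive_comp sinc_inv (fun z => y - z)); [exact D1|].
        auto_derive; [exact I|ring].
      + replace (sinc_inv' (y + z)) with (scal 1 (sinc_inv' (y + z)))
          by (unfold scal; simpl; unfold mult; simpl; ring).
        apply (is_derive_comp sinc_inv (fun z => y + z)); [exact D2|].
        auto_derive; [exact I|ring].
    - intros z Hz. assert (sinc_inv' (y - z) <= sinc_inv' (y + z)); [|lra].
      apply sinc_inv'_incr; lra. }
  rewrite Rminus_0_r, Rplus_0_r in H. lra.
Qed.

(** The multiplier that turns [Delta_(PI/n) / 2] into the derivative. On [1..n] it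
    is [k / sin (k PI / (2 n))], nondecreasing and convex in [k], so its norm is
    its value [n] at [k = n]. *)
Lemma riesz_multiplier (n : nat) : (1 <= n)%nat ->
  exists M : nat -> R,
    (forall k, (1 <= k <= n)%nat -> M k * sin (INR k * (PI / INR n / 2)) = INR k) /\
    (forall D, multiplier_le D M (INR n)).
Proof.
  intros Hn. assert (N0 : 0 < INR n) by (apply lt_0_INR; lia).
  pose proof PI_RGT_0 as HPI.
  set (d := PI / INR n / 2).
  assert (d0 : 0 < d) by (unfold d; apply Rdiv_lt_0_compat; [apply Rdiv_lt_0_compat|]; lra).
  assert (dn : INR n * d = PI / 2) by (unfold d; field; lra).
(* The value at frequency 0 is free, as derivatives and differences of constants
   vanish; repeating the value at frequency 1 keeps the sequence convex. *)
  set (Y := fun j => sinc_inv (INR (max 1 (n - j)) * d) / d).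
  assert (R1 : forall k, (1 <= k <= n)%nat -> 0 < INR k * d /\ INR k * d <= PI / 2).
  { intros k Hk. rewrite <- dn. split.
    - apply Rmult_lt_0_compat; [apply lt_0_INR; lia|exact d0].
    - apply Rmult_le_compat_r; [lra|]. apply le_INR; lia. }
  assert (Ydec : forall i, (S i <= n)%nat -> Y (S i) <= Y i).
  { intros i Hi. unfold Y. apply Rmult_le_compat_r; [left; apply Rinv_0_lt_compat, d0|].
    apply sinc_inv_incr.
    - apply R1; lia.
    - apply Rmult_le_compat_r; [lra|]. apply le_INR; lia.
    - assert (A := R1 (max 1 (n - i)) ltac:(lia)). lra. }
  assert (MX : cos_mixture n Y).
  { apply cos_mixture_convex; [lia|]. split; [|split; [exact Ydec|]].
    - intros i Hi. unfold Y. set (k := max 1 (n - i)).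
      assert (A := R1 k ltac:(lia)).
      assert (0 < sin (INR k * d)) by (apply sin_gt_0; lra).
      left. apply Rdiv_lt_0_compat; [|exact d0]. apply Rdiv_lt_0_compat; lra.
    - intros i Hi. destruct (Nat.eq_dec (S (S i)) n) as [E|E].
      + assert (A := Ydec i ltac:(lia)).
        assert (B : Y (S (S i)) = Y (S i)).
        { unfold Y. do 4 f_equal. lia. }
        rewrite B. lra.
      + unfold Y. replace (max 1 (n - S i)) with (n - S i)%nat by lia.
        set (m := (n - S i)%nat).
        replace (max 1 (n - i)) with (S m) by lia.
        replace (max 1 (n - S (S i))) with (m - 1)%nat by lia.
        rewrite S_INR, minus_INR by lia. simpl (INR 1).
        assert (A1 := R1 (m - 1)%nat ltac:(lia)). assert (A2 := R1 (S m) ltac:(lia)).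
        rewrite minus_INR in A1 by lia. rewrite S_INR in A2. simpl (INR 1) in A1.
        assert (C := sinc_inv_convex (INR m * d) d ltac:(lra) ltac:(lra) ltac:(lra)).
        replace ((INR m - 1) * d) with (INR m * d - d) by ring.
        replace ((INR m + 1) * d) with (INR m * d + d) by ring.
        assert (0 < / d) by (apply Rinv_0_lt_compat; exact d0).
        unfold Rdiv. nra. }
  destruct (periodic_multiplier n Y Hn MX) as [M [HM [_ [_ HB]]]].
  exists M. split.
  - intros k Hk. rewrite HM by lia. unfold Y, sinc_inv.
    replace (max 1 (n - (n - k))) with k by lia. fold d.
    assert (A := R1 k Hk).
    assert (0 < sin (INR k * d)) by (apply sin_gt_0; lra).
    field. lra.
  - intros D. assert (Y0 : Y O = INR n).
    { unfold Y, sinc_inv. replace (max 1 (n - 0)) with n by lia.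
      rewrite dn, sin_PI2. rewrite <- dn. field. lra. }
    rewrite <- Y0. apply multiplier_le_ext with (2 := HB D 1%nat).
    intros k _. f_equal. lia.
Qed.

Lemma fin_diff_S (r : nat) (t : R) (f : R -> R) (x : R) :
  fin_diff (S r) t f x = fin_diff r t f x - fin_diff r t f (x + t).
Proof.
  assert (C0 : forall p, Binomial.C p 0 = 1).
  { intros p. unfold Binomial.C. rewrite Nat.sub_0_r. simpl (INR (Factorial.fact 0)). field.
    apply INR_fact_neq_0. }
  assert (Cn : forall p, Binomial.C p p = 1).
  { intros p. unfold Binomial.C. rewrite Nat.sub_diag. simpl (INR (Factorial.fact 0)). field.
    apply INR_fact_neq_0. }
  unfold fin_diff. rewrite (decomp_sum _ (S r)) by lia. simpl (pred (S r)).
  destruct r as [|r].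
  - simpl. rewrite !C0, Cn. replace (x + t + 0 * t) with (x + 1 * t) by ring. ring.
  - rewrite (decomp_sum (fun j => (-1) ^ j * Binomial.C (S r) j * f (x + INR j * t)) (S r)) by lia.
    simpl (pred (S r)). rewrite !tech5, !C0, !Cn.
    rewrite (sum_eq _ (fun i => (-1) ^ S i * Binomial.C (S r) (S i) * f (x + INR (S i) * t) +
      (-1) * ((-1) ^ i * Binomial.C (S r) i * f (x + t + INR i * t)))).
    + rewrite plus_sum, sum_scal, (S_INR (S r)).
      replace (x + t + INR (S r) * t) with (x + (INR (S r) + 1) * t) by ring.
      simpl pow. ring.
    + intros i Hi. rewrite <- pascal by lia. rewrite (S_INR i).
      replace (x + t + INR i * t) with (x + (INR i + 1) * t) by ring. simpl pow. ring.
Qed.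

Lemma fin_diff_ext (r : nat) (t : R) (f g : R -> R) (x : R) :
  (forall y, f y = g y) -> fin_diff r t f x = fin_diff r t g x.
Proof. intros E. apply sum_eq. intros; rewrite E; reflexivity. Qed.

Lemma fin_diff_minus_le (r : nat) (t : R) (f g : R -> R) (e : R) :
  (forall x, Rabs (f x - g x) <= e) ->
  forall x, Rabs (fin_diff r t f x - fin_diff r t g x) <= 2 ^ r * e.
Proof.
  intros He. induction r as [|r IH]; intros x.
  - unfold fin_diff. simpl. unfold Binomial.C. simpl.
    rewrite Rmult_0_l, Rplus_0_r. replace (1 * (1 / (1 * 1))) with 1 by field.
    rewrite !Rmult_1_l. apply He.
  - rewrite !fin_diff_S. assert (A := IH x). assert (B := IH (x + t)).
    replace (fin_diff r t f x - fin_diff r t f (x + t) -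
       (fin_diff r t g x - fin_diff r t g (x + t)))
      with ((fin_diff r t f x - fin_diff r t g x) -
            (fin_diff r t f (x + t) - fin_diff r t g (x + t))) by ring.
    eapply Rle_trans; [apply Rabs_triang|]. rewrite Rabs_Ropp. simpl pow. lra.
Qed.

(** [cos y - cos (y + c) = - 2 sin (c / 2) cos (y + c / 2 + PI / 2)]: each
    difference turns the phase by a quarter exactly as a derivative does, which is
    what makes the two comparable by an even multiplier. *)
Lemma fin_diff_tpoly (a b : nat -> R) (D r : nat) (psi t : R) (G : nat -> R) (x : R) :
  fin_diff r t (tpoly a b D psi G) x =
  (-1) ^ r * tpoly a b D (psi + INR r * (PI / 2))
    (fun k => (2 * sin (INR k * t / 2)) ^ r * G k) (x + INR r * (t / 2)).
Proof.
  revert x. induction r as [|r IH]; intros x.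
  - unfold fin_diff. simpl. unfold Binomial.C. simpl.
    rewrite !Rmult_0_l, !Rplus_0_r. rewrite (tpoly_ext _ _ _ _ (fun k => 1 * G k) G) by (intros; ring).
    field.
  - rewrite fin_diff_S, !IH, S_INR. simpl pow. rewrite <- Rmult_minus_distr_l.
    rewrite (Rmult_comm (-1) ((-1) ^ r)), Rmult_assoc. f_equal.
    unfold tpoly. rewrite <- minus_sum, <- sum_scal. apply sum_eq. intros k _.
    set (c := INR k * t / 2). set (G' := (2 * sin c) ^ r).
    set (y := INR k * (x + (INR r + 1) * (t / 2)) + (psi + INR r * (PI / 2))).
    replace (INR k * (x + INR r * (t / 2)) + (psi + INR r * (PI / 2))) with (y - c)
      by (unfold y, c; field).
    replace (INR k * (x + t + INR r * (t / 2)) + (psi + INR r * (PI / 2))) with (y + c)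
      by (unfold y, c; field).
    replace (INR k * (x + (INR r + 1) * (t / 2)) + (psi + (INR r + 1) * (PI / 2)))
      with (y + PI / 2) by (unfold y; field).
    rewrite !cos_plus, !sin_plus, cos_minus, sin_minus, cos_PI2, sin_PI2. ring.
Qed.

Lemma is_derive_tpoly (a b : nat -> R) (D : nat) (psi : R) (G : nat -> R) (x : R) :
  is_derive (tpoly a b D psi G) x (tpoly a b D (psi + PI / 2) (fun k => INR k * G k) x).
Proof.
  assert (T : forall k, is_derive
    (fun x => G k * (a k * cos (INR k * x + psi) + b k * sin (INR k * x + psi))) x
    (INR k * G k * (a k * cos (INR k * x + (psi + PI / 2)) + b k * sin (INR k * x + (psi + PI / 2))))).
  { intros k. auto_derive; [exact I|]. rewrite <- Rplus_assoc.
    rewrite (cos_plus _ (PI / 2)), (sin_plus _ (PI / 2)), cos_PI2, sin_PI2. ring. }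
  unfold tpoly. induction D as [|D IH]; simpl sum_f_R0.
  - apply T.
  - apply (is_derive_plus (fun x => sum_f_R0 (fun k => G k *
      (a k * cos (INR k * x + psi) + b k * sin (INR k * x + psi))) D)); [exact IH|apply T].
Qed.

Lemma Derive_n_tpoly (a b : nat -> R) (D r : nat) (psi : R) (G : nat -> R) (x : R) :
  Derive_n (tpoly a b D psi G) r x =
  tpoly a b D (psi + INR r * (PI / 2)) (fun k => INR k ^ r * G k) x.
Proof.
  revert x. induction r as [|r IH]; intros x; simpl Derive_n.
  - simpl INR. rewrite Rmult_0_l, Rplus_0_r. apply tpoly_ext. intros; simpl; ring.
  - rewrite (Derive_ext _ _ x IH). rewrite (is_derive_unique _ _ _ (is_derive_tpoly _ _ _ _ _ _)).
    rewrite S_INR. replace (psi + INR r * (PI / 2) + PI / 2) with (psi + (INR r + 1) * (PI / 2)) by ring.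
    apply tpoly_ext. intros; simpl; ring.
Qed.

Lemma ex_derive_n_tpoly (a b : nat -> R) (D r : nat) (psi : R) (G : nat -> R) (x : R) :
  ex_derive_n (tpoly a b D psi G) r x.
Proof.
  destruct r as [|r]; [exact I|]. simpl.
  eapply ex_derive_ext; [intros y; symmetry; apply Derive_n_tpoly|].
  eexists. apply is_derive_tpoly.
Qed.

Lemma bernstein_nikolskii_stechkin (a b : nat -> R) (D n r : nat) (psi : R) (G : nat -> R) (B : R) :
  (1 <= n)%nat -> (1 <= r)%nat ->
  (forall k, (n < k)%nat -> G k = 0) ->
  (forall x, Rabs (fin_diff r (PI / INR n) (tpoly a b D psi G) x) <= B) ->
  forall x, Rabs (Derive_n (tpoly a b D psi G) r x) <= (INR n / 2) ^ r * B.
Proof.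
  intros Hn Hr HG HB x. rewrite Derive_n_tpoly.
  destruct (riesz_multiplier n Hn) as [M [HM HC]].
  set (t := PI / INR n) in *.
  rewrite (tpoly_ext _ _ _ _ _
    (fun k => (/ 2 * M k) ^ r * ((2 * sin (INR k * t / 2)) ^ r * G k))).
  - assert (P := multiplier_le_pow _ _ _ r (multiplier_le_scal _ (/ 2) _ _ (HC D))).
    rewrite Rabs_pos_eq in P by lra.
    replace (INR n / 2) with (/ 2 * INR n) by field.
    apply P. intros y.
    specialize (HB (y - INR r * (t / 2))). rewrite fin_diff_tpoly in HB.
    replace (y - INR r * (t / 2) + INR r * (t / 2)) with y in HB by ring.
    rewrite Rabs_mult, pow_1_abs, Rmult_1_l in HB. exact HB.
  - intros k _. destruct (Nat.le_gt_cases k n) as [L|L].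
    + rewrite <- Rmult_assoc, <- Rpow_mult_distr. f_equal. f_equal.
      destruct k as [|k].
      * simpl INR. unfold Rdiv. rewrite !Rmult_0_l, sin_0. ring.
      * rewrite <- (HM (S k)) at 1 by lia.
        replace (INR (S k) * t / 2) with (INR (S k) * (t / 2)) by field.
        field_simplify. unfold t. reflexivity.
    + rewrite HG by exact L. ring.
Qed.

(** * Differences of even order as multipliers *)

Lemma tpoly_shift_phase (a b : nat -> R) (D m : nat) (psi : R) (G : nat -> R) (x : R) :
  tpoly a b D (psi + INR (2 * m) * (PI / 2)) G x = (-1) ^ m * tpoly a b D psi G x.
Proof.
  unfold tpoly. rewrite <- sum_scal. apply sum_eq. intros k _.
  replace (INR k * x + (psi + INR (2 * m) * (PI / 2))) with (INR k * x + psi + INR m * PI)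
    by (rewrite mult_INR; simpl (INR 2); field).
  generalize (INR k * x + psi); intros y.
  destruct (cos_sin_INR_PI m) as [C S]. rewrite cos_plus, sin_plus, C, S. ring.
Qed.

Lemma even_fin_diff_multiplier (a b : nat -> R) (D m : nat) (psi t : R) (G : nat -> R) (W : R) :
  (forall x, Rabs (fin_diff (2 * m) t (tpoly a b D psi G) x) <= W) ->
  forall x, Rabs (tpoly a b D psi (fun k => (2 * sin (INR k * t / 2)) ^ (2 * m) * G k) x) <= W.
Proof.
  intros H x. specialize (H (x - INR (2 * m) * (t / 2))).
  rewrite fin_diff_tpoly, tpoly_shift_phase in H.
  replace (x - INR (2 * m) * (t / 2) + INR (2 * m) * (t / 2)) with x in H by ring.
  rewrite !Rabs_mult, !pow_1_abs, !Rmult_1_l in H. exact H.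
Qed.

(** Both sides compute the difference of order [2 m] and step [s] of [cos], taken
    at [- m s]. *)
Lemma pow_sin_expansion (m : nat) (s : R) :
  (2 * sin (s / 2)) ^ (2 * m) =
  sum_f_R0 (fun j => (-1) ^ m * ((-1) ^ j * Binomial.C (2 * m) j) *
    cos ((INR j - INR m) * s)) (2 * m).
Proof.
  pose (a := fun k : nat => INR k).
  assert (H := fin_diff_tpoly a (fun _ => 0) 1 (2 * m) 0 s (fun _ => 1) (- (INR m * s))).
  rewrite tpoly_shift_phase in H.
  assert (E : (-1) ^ m * (-1) ^ m = 1).
  { rewrite <- Rpow_mult_distr. replace (-1 * -1) with 1 by ring. apply pow1. }
  assert (T : forall G x, tpoly a (fun _ => 0) 1 0 G x = G 1%nat * cos x).
  { intros G x. unfold tpoly, a. simpl. replace (1 * x + 0) with x by ring. ring. }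
  rewrite T in H. rewrite (fin_diff_ext _ _ _ cos) in H by (intros; rewrite T; apply Rmult_1_l).
  replace (- (INR m * s) + INR (2 * m) * (s / 2)) with 0 in H
    by (rewrite mult_INR; simpl (INR 2); field).
  rewrite cos_0, pow_mult in H. replace ((-1) ^ 2) with 1 in H by ring.
  rewrite pow1 in H. simpl (INR 1) in H. rewrite !Rmult_1_l, !Rmult_1_r in H.
  transitivity ((-1) ^ m * fin_diff (2 * m) s cos (- (INR m * s))).
  - rewrite H, <- Rmult_assoc, E. ring.
  - unfold fin_diff. rewrite <- sum_scal. apply sum_eq. intros j _.
    replace ((INR j - INR m) * s) with (- (INR m * s) + INR j * s) by ring. ring.
Qed.

(** * Central binomial coefficients *)

Lemma binomial_pos (N j : nat) : 0 < Binomial.C N j.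
Proof.
  unfold Binomial.C. pose proof (INR_fact_lt_0 N). pose proof (INR_fact_lt_0 j).
  pose proof (INR_fact_lt_0 (N - j)). apply Rdiv_lt_0_compat; [lra|nra].
Qed.

Lemma binomial_le_central (m j : nat) : (j <= 2 * m)%nat ->
  Binomial.C (2 * m) j <= Binomial.C (2 * m) m.
Proof.
  assert (L : forall e, (e <= m)%nat -> Binomial.C (2 * m) (m - e) <= Binomial.C (2 * m) m).
  { induction e as [|e IH]; intros He.
    - rewrite Nat.sub_0_r. lra.
    - eapply Rle_trans; [|apply IH; lia].
      replace (m - e)%nat with (S (m - S e)) by lia.
      assert (P := binomial_pos (2 * m) (m - S e)).
      rewrite pascal_step3 by lia.
      assert (H : INR (S (m - S e)) <= INR (2 * m - (m - S e))) by (apply le_INR; lia).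
      assert (0 < INR (S (m - S e))) by (apply lt_0_INR; lia).
      rewrite <- (Rmult_1_l (Binomial.C (2 * m) (m - S e))) at 1.
      apply Rmult_le_compat_r; [lra|].
      apply Rmult_le_reg_r with (INR (S (m - S e))); [lra|].
      unfold Rdiv. rewrite Rmult_assoc, Rinv_l by lra. lra. }
  intros Hj. destruct (Nat.le_gt_cases j m) as [Hle|Hgt].
  - replace j with (m - (m - j))%nat by lia. apply L; lia.
  - rewrite pascal_step1 by lia. replace (2 * m - j)%nat with (m - (j - m))%nat by lia.
    apply L; lia.
Qed.

Lemma central_binomial_S (m : nat) :
  Binomial.C (2 * S m) (S m) * (INR m + 1) = Binomial.C (2 * m) m * (2 * (2 * INR m + 1)).
Proof.
  unfold Binomial.C.
  replace (2 * S m - S m)%nat with (S m) by lia. replace (2 * m - m)%nat with m by lia.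
  replace (2 * S m)%nat with (S (S (2 * m))) by lia.
  rewrite !fact_simpl, !mult_INR, !S_INR, !mult_INR. simpl (INR 2).
  pose proof (INR_fact_neq_0 m). pose proof (pos_INR m). field. lra.
Qed.

(** [16^m <= 4 m binom(2m, m)^2] is preserved by the recurrence because
    [4 m (m + 1) <= (2 m + 1)^2]. *)
Lemma central_binomial_lower (m : nat) : (1 <= m)%nat ->
  / Binomial.C (2 * m) m <= 2 * sqrt (INR m) / 4 ^ m.
Proof.
  intros Hm.
  assert (H : forall e, (16 ^ S e <= 4 * INR (S e) * (Binomial.C (2 * S e) (S e)) ^ 2)).
  { induction e as [|e IH].
    - unfold Binomial.C. simpl. lra.
    - assert (E := central_binomial_S (S e)).
      assert (P := binomial_pos (2 * S e) (S e)).
      assert (x1 : 1 <= INR (S e)) by (apply (le_INR 1); lia).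
      rewrite (S_INR (S e)). set (x := INR (S e)) in *.
      set (c := Binomial.C (2 * S e) (S e)) in *.
      set (c' := Binomial.C (2 * S (S e)) (S (S e))) in *.
      assert (E2 : c' = c * (2 * (2 * x + 1)) / (x + 1)) by (rewrite <- E; field; lra).
      rewrite E2. change (16 ^ S (S e)) with (16 * 16 ^ S e).
      apply Rle_trans with (16 * (4 * x * c ^ 2)); [lra|].
      apply Rmult_le_reg_r with (x + 1); [lra|].
      replace (4 * (x + 1) * (c * (2 * (2 * x + 1)) / (x + 1)) ^ 2 * (x + 1))
        with (16 * c ^ 2 * (2 * x + 1) ^ 2) by (field; lra).
      replace (16 * (4 * x * c ^ 2) * (x + 1)) with (16 * c ^ 2 * (4 * x * (x + 1))) by ring.
      apply Rmult_le_compat_l; [nra|]. nra. }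
  destruct m as [|e]; [lia|]. specialize (H e).
  assert (P := binomial_pos (2 * S e) (S e)).
  assert (x0 : 0 < INR (S e)) by (apply lt_0_INR; lia).
  assert (s0 := sqrt_lt_R0 _ x0). assert (s2 := sqrt_sqrt (INR (S e)) ltac:(lra)).
  set (c := Binomial.C (2 * S e) (S e)) in *. set (s := sqrt (INR (S e))) in *.
  assert (F : 0 < 4 ^ S e) by (apply pow_lt; lra).
  assert (G : 4 ^ S e <= 2 * s * c).
  { apply Rsqr_incr_0_var; [|nra].
    unfold Rsqr. rewrite <- Rpow_mult_distr. replace (4 * 4) with 16 by ring.
    replace (2 * s * c * (2 * s * c)) with (4 * (s * s) * c ^ 2) by ring. rewrite s2. lra. }
  apply Rmult_le_reg_r with (c * 4 ^ S e); [nra|].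
  replace (/ c * (c * 4 ^ S e)) with (4 ^ S e) by (field; lra).
  replace (2 * s / 4 ^ S e * (c * 4 ^ S e)) with (2 * s * c) by (field; lra). exact G.
Qed.

(** * Averages of multipliers *)

Lemma is_RInt_sum (u : nat -> R -> R) (l : nat -> R) (x y : R) (N : nat) :
  (forall k, (k <= N)%nat -> is_RInt (u k) x y (l k)) ->
  is_RInt (fun t => sum_f_R0 (fun k => u k t) N) x y (sum_f_R0 l N).
Proof.
  induction N as [|N IH]; intros H; simpl.
  - apply H; lia.
  - apply (is_RInt_plus (fun t => sum_f_R0 (fun k => u k t) N) (u (S N))).
    + apply IH. intros; apply H; lia.
    + apply H; lia.
Qed.

Lemma multiplier_average (a b : nat -> R) (D : nat) (psi h W : R) (G : nat -> R)
    (phi : R -> R) (S : nat -> R -> R) (w : nat -> R) : 0 <= h ->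
  (forall t, 0 < t < h -> 0 <= phi t) -> is_RInt phi 0 h 1 ->
  (forall k, is_RInt (fun t => phi t * S k t) 0 h (w k)) ->
  (forall t, 0 < t < h -> forall x, Rabs (tpoly a b D psi (fun k => S k t * G k) x) <= W) ->
  forall x, Rabs (tpoly a b D psi (fun k => w k * G k) x) <= W.
Proof.
  intros Hh Hphi H1 Hw HW x.
  assert (I : is_RInt (fun t => phi t * tpoly a b D psi (fun k => S k t * G k) x) 0 h
    (tpoly a b D psi (fun k => w k * G k) x)).
  { apply is_RInt_ext with (fun t => sum_f_R0 (fun k => G k *
      (a k * cos (INR k * x + psi) + b k * sin (INR k * x + psi)) * (phi t * S k t)) D).
    - intros t _. unfold tpoly. rewrite <- sum_scal. apply sum_eq. intros; ring.
    - unfold tpoly.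
      rewrite (sum_eq _ (fun k => G k * (a k * cos (INR k * x + psi) + b k * sin (INR k * x + psi))
        * w k)) by (intros; ring).
      apply (is_RInt_sum (fun k t => G k *
      (a k * cos (INR k * x + psi) + b k * sin (INR k * x + psi)) * (phi t * S k t))).
      intros k _. apply (is_RInt_scal (fun t => phi t * S k t)). apply Hw. }
  assert (U : is_RInt (fun t => W * phi t) 0 h (W * 1)) by (apply (is_RInt_scal phi), H1).
  assert (L : is_RInt (fun t => - W * phi t) 0 h (- W * 1)) by (apply (is_RInt_scal phi), H1).
  assert (B : forall t, 0 < t < h ->
    - W * phi t <= phi t * tpoly a b D psi (fun k => S k t * G k) x <= W * phi t).
  { intros t Ht. specialize (HW t Ht x). specialize (Hphi t Ht).
    apply Rabs_le_between in HW. nra. }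
  apply Rabs_le. split.
  - replace (- W) with (- W * 1) by ring.
    apply (is_RInt_le _ _ 0 h _ _ Hh L I). intros t Ht. apply B, Ht.
  - replace W with (W * 1) by ring.
    apply (is_RInt_le _ _ 0 h _ _ Hh I U). intros t Ht. apply B, Ht.
Qed.

(** The density on [0, h] of [|t|] when [t] has the triangular density on
    [-h, h]; [tent_transform] is its cosine transform, a squared sinc, whose
    decay of order two makes the sum over the noncentral terms converge. *)
Definition tent_weight (h t : R) : R := 2 / h * (1 - t / h).

Definition tent_transform (s : R) : R :=
  if Req_EM_T s 0 then 1 else 2 * (1 - cos s) / s ^ 2.

Lemma is_RInt_tent_weight_cos (h xi : R) : 0 < h ->
  is_RInt (fun t => tent_weight h t * cos (xi * t)) 0 h (tent_transform (xi * h)).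
Proof.
  intros Hh. unfold tent_transform, tent_weight. destruct (Req_EM_T (xi * h) 0) as [Z|NZ].
  - assert (xi = 0) as -> by (apply Rmult_integral in Z; lra).
    set (P := fun t => 2 / h * (t - t ^ 2 / (2 * h))).
    assert (E : P h - P 0 = 1) by (unfold P; field; lra). 
    apply is_RInt_ext with (fun t => 2 / h * (1 - t / h)).
    + intros t _. rewrite Rmult_0_l, cos_0. symmetry. apply Rmult_1_r.
    + cut (is_RInt (fun t => 2 / h * (1 - t / h)) 0 h (P h - P 0)); [rewrite E; auto|].
      apply (is_RInt_derive P).
      * intros t _. unfold P. auto_derive; [lra|]. field. lra.
      * intros t _. apply (ex_derive_continuous (fun t => 2 / h * (1 - t / h))).
        auto_derive. lra.
  - assert (xi <> 0) by (intros ->; apply NZ; ring).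
    set (P := fun t => 2 / h * ((1 - t / h) * sin (xi * t) / xi - cos (xi * t) / (xi ^ 2 * h))).
    replace (2 * (1 - cos (xi * h)) / (xi * h) ^ 2) with (P h - P 0).
    + apply (is_RInt_derive P).
      * intros t _. unfold P. auto_derive; [repeat split; auto; lra|]. field. split; lra.
      * intros t _. apply (ex_derive_continuous (fun t => 2 / h * (1 - t / h) * cos (xi * t))).
        auto_derive. lra.
    + unfold P. rewrite Rmult_0_r, sin_0, cos_0. field. split; lra.
Qed.

(** * High frequencies *)

Lemma inv_sq_diff (x : R) : 0 < x ->
  0 <= / x ^ 2 - / (x + 1) ^ 2 /\
  / (x + 1) ^ 2 - / (x + 2) ^ 2 <= / x ^ 2 - / (x + 1) ^ 2 /\
  / x ^ 2 - / (x + 1) ^ 2 <= 2 / x ^ 3.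
Proof.
  intros Hx.
  assert (0 < x ^ 2 * (x + 1) ^ 2) by (apply Rmult_lt_0_compat; apply pow_lt; lra).
  assert (0 < x ^ 3 * (x + 1) ^ 2) by (apply Rmult_lt_0_compat; apply pow_lt; lra).
  assert (0 < x ^ 2 * (x + 1) ^ 2 * (x + 2) ^ 2)
    by (apply Rmult_lt_0_compat; [lra|]; apply pow_lt; lra).
  split; [|split].
  - replace (/ x ^ 2 - / (x + 1) ^ 2) with ((2 * x + 1) / (x ^ 2 * (x + 1) ^ 2)) by (field; lra).
    apply Rdiv_le_0_compat; lra.
  - apply Rminus_le_0.
    replace (/ x ^ 2 - / (x + 1) ^ 2 - (/ (x + 1) ^ 2 - / (x + 2) ^ 2))
      with ((6 * (x + 1) ^ 2 - 2) / (x ^ 2 * (x + 1) ^ 2 * (x + 2) ^ 2)) by (field; lra).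
    apply Rdiv_le_0_compat; nra.
  - apply Rminus_le_0.
    replace (2 / x ^ 3 - (/ x ^ 2 - / (x + 1) ^ 2))
      with ((3 * x + 2) / (x ^ 3 * (x + 1) ^ 2)) by (field; lra).
    apply Rdiv_le_0_compat; lra.
Qed.

(** [1 / k^2] on [k >= N], continued below [N] by a line steep enough to preserve
    convexity; the value at [0] is [3 / N^2]. *)
Definition inv_sq_convex (N k : nat) : R :=
  if lt_dec k N then / INR N ^ 2 + INR (N - k) * (2 / INR N ^ 3) else / INR k ^ 2.

Lemma inv_sq_convex_decreasing (N K : nat) : (1 <= N)%nat ->
  convex_decreasing K (inv_sq_convex N).
Proof.
  intros HN. assert (N0 : 0 < INR N) by (apply lt_0_INR; lia).
  assert (P3 : 0 < 2 / INR N ^ 3) by (apply Rdiv_lt_0_compat; [lra|apply pow_lt; lra]).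
  assert (P2 : 0 < / INR N ^ 2) by (apply Rinv_0_lt_compat; apply pow_lt; lra).
  assert (E : forall i, inv_sq_convex N i - inv_sq_convex N (S i) =
    if lt_dec i N then 2 / INR N ^ 3 else / INR i ^ 2 - / (INR i + 1) ^ 2).
  { intros i. unfold inv_sq_convex. destruct (lt_dec i N), (lt_dec (S i) N); try lia.
    - replace (N - i)%nat with (S (N - S i)) by lia. rewrite S_INR. ring.
    - replace N with (S i) by lia. rewrite Nat.sub_succ_l, Nat.sub_diag by lia.
      simpl (INR 1). ring.
    - rewrite S_INR. reflexivity. }
  assert (Pos : forall i, (N <= i)%nat -> 0 < INR i) by (intros; apply lt_0_INR; lia).
  split; [|split].
  - intros i _. unfold inv_sq_convex. destruct (lt_dec i N).
    + assert (0 <= INR (N - i)) by apply pos_INR. nra.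
    + left. apply Rinv_0_lt_compat, pow_lt, Pos. lia.
  - intros i _. assert (H := E i). destruct (lt_dec i N); [lra|].
    assert (H' := inv_sq_diff (INR i) (Pos i ltac:(lia))). lra.
  - intros i _. rewrite !E. destruct (lt_dec i N), (lt_dec (S i) N); try lia.
    + lra.
    + replace N with (S i) by lia. apply inv_sq_diff. apply lt_0_INR. lia.
    + rewrite S_INR. replace (INR i + 1 + 1) with (INR i + 2) by ring.
      apply inv_sq_diff, Pos. lia.
Qed.

(** For an integer [d <> 0], [1 / d^2 <= 1 / (d - 1/2) - 1 / (d + 1/2)], which
    telescopes; the missing term [d = 0] of the telescoping sum contributes
    [- 4]. *)
Lemma sum_inv_sq_le (m N : nat) :
  sum_f_R0 (fun j => if Nat.eq_dec j m then 0 else / (INR j - INR m) ^ 2) N <= 4.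
Proof.
  set (p := fun x : R => / (x - INR m - / 2)).
  assert (NI : forall i, (i < m)%nat -> INR i - INR m <= -1).
  { intros i Hi. replace m with (S i + (m - S i))%nat by lia.
    rewrite plus_INR, S_INR. pose proof (pos_INR (m - S i)). lra. }
  assert (GE : forall i, (m < i)%nat -> 1 <= INR i - INR m).
  { intros i Hi. rewrite <- minus_INR by lia. apply (le_INR 1). lia. }
  assert (T : forall d, d <= -1 \/ 1 <= d -> / d ^ 2 <= / (d - / 2) - / (d + / 2)).
  { intros d Hd. assert (0 < d ^ 2 - / 4) by nra.
    replace (/ (d - / 2) - / (d + / 2)) with (/ (d ^ 2 - / 4))
      by (field; repeat split; nra).
    apply Rinv_le_contravar; lra. }
  assert (H : sum_f_R0 (fun j => if Nat.eq_dec j m then 0 else / (INR j - INR m) ^ 2) N <=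
    p (INR 0) - p (INR N + 1) + if le_dec m N then 4 else 0).
  { assert (T0 : forall i, (if Nat.eq_dec i m then 0 else / (INR i - INR m) ^ 2) <=
      p (INR i) - p (INR i + 1) + if Nat.eq_dec i m then 4 else 0).
    { intros i. unfold p.
      replace (INR i + 1 - INR m - / 2) with (INR i - INR m + / 2) by field.
      destruct (Nat.eq_dec i m) as [->|Hi].
      - rewrite Rminus_diag. replace (0 - / 2) with (- / 2) by ring.
        rewrite Rplus_0_l, Rinv_opp, Rinv_inv. lra.
      - rewrite Rplus_0_r. apply T.
        destruct (Nat.lt_ge_cases i m); [left; apply NI|right; apply GE]; lia. }
    induction N as [|N IH].
    - specialize (T0 O). cbn [sum_f_R0].
      destruct (Nat.eq_dec 0 m), (le_dec m 0); try lia; exact T0.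
    - rewrite tech5. specialize (T0 (S N)). rewrite S_INR in *.
      destruct (Nat.eq_dec (S N) m), (le_dec m N), (le_dec m (S N)); try lia; lra. }
  assert (Hp0 : p (INR 0) <= 0).
  { unfold p. simpl (INR 0). left. apply Rinv_lt_0_compat. pose proof (pos_INR m). lra. }
  assert (HpN : - p (INR N + 1) + (if le_dec m N then 4 else 0) <= 4).
  { unfold p. destruct (le_dec m N) as [L|L].
    - assert (A := GE (S N) ltac:(lia)). rewrite S_INR in A.
      assert (0 < / (INR N + 1 - INR m - / 2)) by (apply Rinv_0_lt_compat; lra). lra.
    - assert (A := NI N ltac:(lia)).
      rewrite <- Rinv_opp.
      assert (/ - (INR N + 1 - INR m - / 2) <= / / 2) by (apply Rinv_le_contravar; lra).
      rewrite Rinv_inv in H0. lra. }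
  lra.
Qed.

Lemma Rabs_minus_one : Rabs (-1) = 1.
Proof. rewrite Rabs_left; lra. Qed.

(** The de la Vallee Poussin multiplier. *)
Definition trapezoid (N k : nat) : R := / INR N * (INR (2 * N - k) + (-1) * INR (N - k)).

Lemma trapezoid_low (N k : nat) : (1 <= N)%nat -> (k <= N)%nat -> trapezoid N k = 1.
Proof.
  intros HN Hk. unfold trapezoid. rewrite !minus_INR, mult_INR by lia. simpl (INR 2).
  field. assert (0 < INR N) by (apply lt_0_INR; lia). lra.
Qed.

Lemma trapezoid_high (N k : nat) : (2 * N <= k)%nat -> trapezoid N k = 0.
Proof.
  intros Hk. unfold trapezoid. replace (2 * N - k)%nat with O by lia.
  replace (N - k)%nat with O by lia. simpl; ring.
Qed.

Lemma trapezoid_multiplier (N D : nat) : (1 <= N)%nat -> multiplier_le D (trapezoid N) 3.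
Proof.
  intros HN. assert (N0 : 0 < INR N) by (apply lt_0_INR; lia).
  set (K := (D + 2 * N)%nat).
  assert (M2 := convex_multiplier K D _ ltac:(unfold K; lia)
    (cos_mixture_tent K (2 * N) ltac:(unfold K; lia) ltac:(unfold K; lia))).
  assert (M1 := convex_multiplier K D _ ltac:(unfold K; lia)
    (cos_mixture_tent K N ltac:(unfold K; lia) ltac:(unfold K; lia))).
  cbv beta in M1, M2. rewrite Nat.sub_0_r in M1, M2. rewrite mult_INR in M2.
  assert (M := multiplier_le_scal _ (/ INR N) _ _
    (multiplier_le_plus _ _ _ _ _ M2 (multiplier_le_scal _ (-1) _ _ M1))).
  apply multiplier_le_weaken with (2 := M).
  rewrite Rabs_minus_one, Rabs_pos_eq
    by (left; apply Rinv_0_lt_compat, N0).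
  simpl (INR 2). right. field. lra.
Qed.

Lemma high_pass_multiplier (N D : nat) : (1 <= N)%nat ->
  multiplier_le D (fun k => 1 - trapezoid N k) 4.
Proof.
  intros HN. apply multiplier_le_ext with (fun k => 1 + (-1) * trapezoid N k); [intros; ring|].
  apply multiplier_le_weaken with (1 + Rabs (-1) * 3).
  - rewrite Rabs_minus_one. lra.
  - apply multiplier_le_plus; [apply multiplier_le_one|].
    apply multiplier_le_scal, trapezoid_multiplier, HN.
Qed.

Lemma tpoly_bounded (a b : nat -> R) (D : nat) (psi : R) (G : nat -> R) :
  exists B, forall x, Rabs (tpoly a b D psi G x) <= B.
Proof.
  exists (sum_f_R0 (fun k => Rabs (G k) * (Rabs (a k) + Rabs (b k))) D). intros x.
  unfold tpoly. eapply Rle_trans; [apply Rsum_abs|]. apply sum_Rle. intros k _.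
  rewrite Rabs_mult. apply Rmult_le_compat_l; [apply Rabs_pos|].
  eapply Rle_trans; [apply Rabs_triang|]. rewrite !Rabs_mult.
  assert (Rabs (cos (INR k * x + psi)) <= 1) by (apply Rabs_le, COS_bound).
  assert (Rabs (sin (INR k * x + psi)) <= 1) by (apply Rabs_le, SIN_bound).
  pose proof (Rabs_pos (a k)). pose proof (Rabs_pos (b k)). nra.
Qed.

(** The hypothesis applied to the least bound [s] gives [s <= c + s / 2]. *)
Lemma contraction_bound (F : R -> R) (c : R) :
  (exists B, forall x, Rabs (F x) <= B) ->
  (forall B, (forall x, Rabs (F x) <= B) -> forall x, Rabs (F x) <= c + B / 2) ->
  forall x, Rabs (F x) <= 2 * c.
Proof.
  intros [B HB] H x.
  destruct (completeness (fun y => exists x, y = Rabs (F x))) as [s [U L]].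
  - exists B. intros y [z ->]. apply HB.
  - exists (Rabs (F 0)), 0. reflexivity.
  - assert (Hs : s <= c + s / 2).
    { apply L. intros y [z ->]. apply H. intros z'. apply U. exists z'. reflexivity. }
    assert (Rabs (F x) <= s) by (apply U; exists x; reflexivity). lra.
Qed.

Lemma sum_single (m N : nat) (c : R) : (m <= N)%nat ->
  sum_f_R0 (fun j => if Nat.eq_dec j m then c else 0) N = c.
Proof.
  intros Hm.
  assert (Z : forall M, (M < m)%nat -> sum_f_R0 (fun j => if Nat.eq_dec j m then c else 0) M = 0).
  { induction M as [|M IH]; intros H; cbn [sum_f_R0].
    - destruct (Nat.eq_dec 0 m); [lia|reflexivity].
    - rewrite IH by lia. destruct (Nat.eq_dec (S M) m); [lia|ring]. }
  induction N as [|N IH].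
  - cbn [sum_f_R0]. destruct (Nat.eq_dec 0 m); [reflexivity|lia].
  - rewrite tech5. destruct (Nat.eq_dec (S N) m).
    + rewrite Z by lia. ring.
    + rewrite IH by lia. ring.
Qed.

(** With [w] the averaged difference and [U] a multiplier of norm at most [1/2] that
    agrees with [1 - w] on [k >= 4 n], the high part [y] of the polynomial [f] satisfies
    [y = (1 - V) (w f) + U y], where [1 - V] has norm at most [4]: a contraction. The
    choice [4 n] comes from the bound [48 / (h N)^2] for the norm of [U], with
    [h N = 4 PI]. *)
Lemma high_frequency_bound (a b : nat -> R) (D m n : nat) (psi W : R) :
  (1 <= m)%nat -> (1 <= n)%nat ->
  (forall t, Rabs t <= PI / INR n -> forall x,
    Rabs (tpoly a b D psi (fun k => (2 * sin (INR k * t / 2)) ^ (2 * m) * 1) x) <= W) ->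
  forall x, Rabs (tpoly a b D psi (fun k => 1 - trapezoid (4 * n) k) x) <=
    8 * (/ Binomial.C (2 * m) m * W).
Proof.
  intros Hm Hn HW.
  assert (n0 : 0 < INR n) by (apply lt_0_INR; lia).
  pose proof PI_RGT_0 as pi0.
  set (h := PI / INR n) in *. set (N := (4 * n)%nat).
  assert (h0 : 0 < h) by (apply Rdiv_lt_0_compat; lra).
  set (Cm := Binomial.C (2 * m) m). assert (Cm0 : 0 < Cm) by apply binomial_pos.
  set (c := fun j => (-1) ^ m * ((-1) ^ j * Binomial.C (2 * m) j) / Cm).
  assert (cm : c m = 1).
  { unfold c. fold Cm. rewrite <- Rmult_assoc, <- Rpow_mult_distr.
    replace (-1 * -1) with 1 by ring. rewrite pow1. field. lra. }
  assert (cj : forall j, (j <= 2 * m)%nat -> Rabs (c j) <= 1).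
  { intros j Hj. unfold c, Rdiv. rewrite !Rabs_mult, !pow_1_abs, !Rmult_1_l.
    pose proof (binomial_pos (2 * m) j). pose proof (binomial_le_central m j Hj).
    rewrite !Rabs_pos_eq by (try (left; apply Rinv_0_lt_compat); lra).
    apply Rmult_le_reg_r with Cm; [lra|]. rewrite Rmult_assoc, Rinv_l by lra. fold Cm in H0. lra. }
(* [w] is the average of the normalised differences: its terms are the cosine
   transforms of the tent at the frequencies [(j - m) k]. *)
  set (w := fun k => sum_f_R0 (fun j => c j *
    tent_transform ((INR j - INR m) * INR k * h)) (2 * m)).
  assert (Hw : forall x, Rabs (tpoly a b D psi (fun k => w k * 1) x) <= / Cm * W).
  { apply (multiplier_average a b D psi h (/ Cm * W) (fun _ => 1) (tent_weight h)
      (fun k t => / Cm * (2 * sin (INR k * t / 2)) ^ (2 * m)) w).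
    - lra.
    - intros t Ht. unfold tent_weight. apply Rmult_le_pos.
      + left. apply Rdiv_lt_0_compat; lra.
      + assert (t / h < 1); [|lra]. apply Rmult_lt_reg_r with h; [lra|].
        unfold Rdiv. rewrite Rmult_assoc, Rinv_l by lra. lra.
    - assert (I := is_RInt_tent_weight_cos h 0 h0). unfold tent_transform in I.
      destruct (Req_EM_T (0 * h) 0) as [_|NZ]; [|exfalso; apply NZ; ring].
      apply is_RInt_ext with (2 := I). intros t _. rewrite Rmult_0_l, cos_0. apply Rmult_1_r.
    - intros k. apply is_RInt_ext with (fun t => sum_f_R0 (fun j => c j *
        (tent_weight h t * cos ((INR j - INR m) * INR k * t))) (2 * m)).
      + intros t _. rewrite pow_sin_expansion, <- !sum_scal. apply sum_eq. intros j _.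
        unfold c. rewrite <- Rmult_assoc with (r3 := t). field. lra.
      + apply (is_RInt_sum (fun j t => c j *
          (tent_weight h t * cos ((INR j - INR m) * INR k * t)))).
        intros j _. apply (is_RInt_scal (fun t => tent_weight h t * _)).
        apply is_RInt_tent_weight_cos, h0.
    - intros t Ht x.
      rewrite (tpoly_ext _ _ _ _ _ (fun k => / Cm * ((2 * sin (INR k * t / 2)) ^ (2 * m) * 1)))
        by (intros; ring).
      rewrite tpoly_scal, Rabs_mult, Rabs_pos_eq by (left; apply Rinv_0_lt_compat, Cm0).
      apply Rmult_le_compat_l; [left; apply Rinv_0_lt_compat, Cm0|].
      apply HW. rewrite Rabs_pos_eq; lra. }
  set (v := fun j => if Nat.eq_dec j m then 0 else - c j * (2 / ((INR j - INR m) * h) ^ 2)).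
(* The factor [1 / k^2] of every noncentral term is replaced by its convex
   continuation below [N], whose norm is known. *)
  set (U := fun k => sum_f_R0 (fun j => v j * (1 + (-1) * cos (INR k * ((INR j - INR m) * h))))
    (2 * m) * inv_sq_convex N k).
  assert (N0 : 0 < INR N) by (apply lt_0_INR; unfold N; lia).
  assert (NE : forall j, j <> m -> INR j - INR m <> 0).
  { intros j Hj E. apply Hj, INR_eq. lra. }
  assert (HU : multiplier_le D U (/ 2)).
  { apply multiplier_le_weaken with (16 / h ^ 2 * (3 / INR N ^ 2)).
    - assert (hN : h * INR N = 4 * PI).
      { unfold h, N. rewrite mult_INR. simpl (INR 4). field. lra. }
      replace (16 / h ^ 2 * (3 / INR N ^ 2)) with (48 / (h * INR N) ^ 2) by (field; lra).
      rewrite hN. pose proof PI2_3_2. unfold PI2 in *.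
      apply Rmult_le_reg_r with ((4 * PI) ^ 2); [apply pow_lt; lra|].
      unfold Rdiv. rewrite Rmult_assoc, Rinv_l by (apply pow_nonzero; lra). nra.
    - apply (multiplier_le_mult D (fun k => sum_f_R0 (fun j => v j *
        (1 + (-1) * cos (INR k * ((INR j - INR m) * h)))) (2 * m)) (inv_sq_convex N)).
      + apply multiplier_le_weaken with (sum_f_R0 (fun j => Rabs (v j) * 2) (2 * m)).
        * apply Rle_trans with (sum_f_R0 (fun j => 4 / h ^ 2 *
            (if Nat.eq_dec j m then 0 else / (INR j - INR m) ^ 2)) (2 * m)).
          -- apply sum_Rle. intros j Hj. unfold v. destruct (Nat.eq_dec j m) as [_|Hne].
             ++ rewrite Rabs_R0. lra.
             ++ specialize (NE j Hne). rewrite Rabs_mult, Rabs_Ropp.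
                assert (0 < ((INR j - INR m) * h) ^ 2).
                { apply pow2_gt_0. apply Rmult_integral_contrapositive_currified; lra. }
                assert (0 < 2 / ((INR j - INR m) * h) ^ 2) by (apply Rdiv_lt_0_compat; lra).
                rewrite (Rabs_pos_eq (2 / _)) by lra.
                replace (4 / h ^ 2 * / (INR j - INR m) ^ 2)
                  with (1 * (2 / ((INR j - INR m) * h) ^ 2) * 2) by (field; lra).
                specialize (cj j Hj). nra.
          -- rewrite sum_scal. pose proof (sum_inv_sq_le m (2 * m)).
             assert (0 < 4 / h ^ 2) by (apply Rdiv_lt_0_compat; [lra|apply pow_lt; lra]).
             replace (16 / h ^ 2) with (4 / h ^ 2 * 4) by (field; lra). nra.
        * apply (multiplier_le_sum D (fun j k => v j *
            (1 + (-1) * cos (INR k * ((INR j - INR m) * h))))).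
          intros j _. apply multiplier_le_scal.
          replace 2 with (1 + Rabs (-1) * 1) by (rewrite Rabs_minus_one; ring).
          apply multiplier_le_plus; [apply multiplier_le_one|].
          apply multiplier_le_scal, multiplier_le_cos.
      + replace (3 / INR N ^ 2) with (inv_sq_convex N 0).
        * apply (convex_multiplier (S D)); [lia|]. apply cos_mixture_convex; [lia|].
          apply inv_sq_convex_decreasing. unfold N; lia.
        * unfold inv_sq_convex. destruct (lt_dec 0 N) as [_|L]; [|unfold N in L; lia].
          rewrite Nat.sub_0_r. field. lra. }
  assert (Hsplit : forall k, (N <= k)%nat -> w k + U k = 1).
  { intros k Hk. assert (k0 : 0 < INR k) by (apply lt_0_INR; unfold N in Hk; lia).
    unfold w, U, inv_sq_convex. destruct (lt_dec k N); [lia|].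
    rewrite Rmult_comm, <- sum_scal, <- plus_sum.
    rewrite <- (sum_single m (2 * m) 1) at 1 by lia. apply sum_eq. intros j _.
    unfold v, tent_transform. destruct (Nat.eq_dec j m) as [->|Hne].
    - rewrite cm, Rminus_diag. destruct (Req_EM_T (0 * INR k * h) 0) as [_|NZ]; [ring|].
      exfalso; apply NZ; ring.
    - specialize (NE j Hne). destruct (Req_EM_T ((INR j - INR m) * INR k * h) 0) as [Z|_].
      + exfalso. apply Rmult_integral in Z. destruct Z as [Z|Z]; [|lra].
        apply Rmult_integral in Z. lra.
      + replace (INR k * ((INR j - INR m) * h)) with ((INR j - INR m) * INR k * h) by ring.
        field. lra. }
  replace (8 * (/ Cm * W)) with (2 * (4 * (/ Cm * W))) by ring.
  apply contraction_bound; [apply tpoly_bounded|].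
  intros B HB x.
  rewrite (tpoly_ext _ _ _ _ _ (fun k => (1 - trapezoid N k) * (w k * 1) + U k * (1 - trapezoid N k))).
  - rewrite tpoly_plus. eapply Rle_trans; [apply Rabs_triang|]. apply Rplus_le_compat.
    + apply high_pass_multiplier; [unfold N; lia|exact Hw].
    + replace (B / 2) with (/ 2 * B) by field. apply HU. exact HB.
  - intros k _. destruct (Nat.le_gt_cases k N) as [L|L].
    + rewrite trapezoid_low; [ring| |exact L]. unfold N; lia.
    + assert (E := Hsplit k ltac:(lia)).
      replace (1 - trapezoid N k) with ((1 - trapezoid N k) * (w k + U k)) at 1
        by (rewrite E; ring). ring.
Qed.

(** * Middle frequencies *)

Lemma convex_decreasing_mult (K : nat) (Y Z : nat -> R) :
  convex_decreasing K Y -> convex_decreasing K Z -> convex_decreasing K (fun i => Y i * Z i).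
Proof.
  intros [Yp [Yd Yc]] [Zp [Zd Zc]]. split; [|split].
  - intros i Hi. apply Rmult_le_pos; auto.
  - intros i Hi. apply Rmult_le_compat; auto.
  - intros i Hi.
    replace (Y (S i) * Z (S i) - Y (S (S i)) * Z (S (S i)))
      with (Y (S i) * (Z (S i) - Z (S (S i))) + Z (S (S i)) * (Y (S i) - Y (S (S i)))) by ring.
    replace (Y i * Z i - Y (S i) * Z (S i))
      with (Y i * (Z i - Z (S i)) + Z (S i) * (Y i - Y (S i))) by ring.
    assert (A1 := Yd (S i) Hi). assert (A2 := Zd (S i) Hi).
    apply Rplus_le_compat; apply Rmult_le_compat.
    + apply Yp; lia.
    + lra.
    + apply Yd; lia.
    + apply Zc; exact Hi.
    + apply Zp; lia.
    + lra.
    + exact A2.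
    + apply Yc; exact Hi.
Qed.

Lemma convex_decreasing_pow (K p : nat) (Y : nat -> R) :
  convex_decreasing K Y -> convex_decreasing K (fun i => Y i ^ p).
Proof.
  intros H. induction p as [|p IH]; simpl.
  - repeat split; intros; lra.
  - apply convex_decreasing_mult; assumption.
Qed.

Lemma sec_convex (y e : R) : - (PI / 2) < y - e -> y + e < PI / 2 -> 0 <= e ->
  2 / cos y <= / cos (y - e) + / cos (y + e).
Proof.
  intros H1 H2 He.
  assert (C1 : 0 < cos (y - e)) by (apply cos_gt_0; lra).
  assert (C2 : 0 < cos (y + e)) by (apply cos_gt_0; lra).
  assert (C3 : 0 < cos y) by (apply cos_gt_0; lra).
  assert (P : cos (y - e) * cos (y + e) = cos y ^ 2 - sin e ^ 2).
  { rewrite cos_minus, cos_plus. assert (A := sin2_cos2 y). assert (B := sin2_cos2 e).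
    unfold Rsqr in *.
    replace ((cos y * cos e + sin y * sin e) * (cos y * cos e - sin y * sin e))
      with (cos y ^ 2 * (cos e * cos e) - (sin y * sin y) * sin e ^ 2) by ring.
    replace (cos e * cos e) with (1 - sin e * sin e) by lra.
    replace (sin y * sin y) with (1 - cos y * cos y) by lra. ring. }
  assert (S : cos (y - e) + cos (y + e) = 2 * cos y * cos e)
    by (rewrite cos_minus, cos_plus; ring).
  replace (/ cos (y - e) + / cos (y + e))
    with (2 * cos y * cos e / (cos (y - e) * cos (y + e))) by (rewrite <- S; field; lra).
  apply Rmult_le_reg_r with (cos y * (cos (y - e) * cos (y + e)));
    [repeat apply Rmult_lt_0_compat; lra|].
  replace (2 / cos y * (cos y * (cos (y - e) * cos (y + e))))
    with (2 * (cos (y - e) * cos (y + e))) by (field; lra).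
  replace (2 * cos y * cos e / (cos (y - e) * cos (y + e)) * (cos y * (cos (y - e) * cos (y + e))))
    with (2 * cos y ^ 2 * cos e) by (field; lra).
  rewrite P. assert (B := sin2_cos2 e). unfold Rsqr in B.
  assert (cos y ^ 2 * (1 - cos e) <= sin e ^ 2); [|lra].
  replace (sin e ^ 2) with ((1 + cos e) * (1 - cos e)) by (ring_simplify; lra).
  assert (E1 := COS_bound e). assert (E2 := COS_bound y).
  assert (0 <= cos e) by (apply cos_ge_0; lra).
  apply Rmult_le_compat_r; [lra|]. nra.
Qed.

(** Around its minimum [k = K], the function [1 / sin (k PI / (2 K))^(2m)] is the
    power [2m] of a secant, hence convex. Cut off at distance [K / (2 q)] and
    repeated periodically, it has its peaks at the ends of these intervals, and its
    norm is the value there. As [K] is a multiple of the period [K / q], the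
    periodic function is also even about [0] and is a cosine series. *)
Lemma cosecant_multiplier (K q m : nat) : (1 <= K)%nat -> (1 <= q)%nat ->
  exists X : nat -> R,
    (forall D, multiplier_le D X (/ cos (PI / (4 * INR q)) ^ (2 * m))) /\
    (forall k, (2 * q * ((k - K) + (K - k)) <= K)%nat ->
      X k * sin (INR k * (PI / INR K) / 2) ^ (2 * m) = 1).
Proof.
  intros HK Hq. pose proof PI_RGT_0 as pi0.
  assert (K0 : 1 <= INR K) by (apply (le_INR 1); lia).
  assert (q0 : 1 <= INR q) by (apply (le_INR 1); lia).
  set (d := PI / (4 * INR q * INR K)).
  assert (d0 : 0 < d) by (apply Rdiv_lt_0_compat; nra).
  assert (Kd : INR K * d = PI / (4 * INR q)) by (unfold d; field; lra).
  assert (qd : PI / (4 * INR q) <= PI / 4).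
  { apply Rmult_le_compat_l; [lra|]. apply Rinv_le_contravar; lra. }
  assert (J : forall j, (j <= K)%nat -> 0 <= INR j * d <= PI / 4).
  { intros j Hj. split; [apply Rmult_le_pos; [apply pos_INR|lra]|].
    apply Rle_trans with (INR K * d); [|lra].
    apply Rmult_le_compat_r; [lra|]. apply le_INR, Hj. }
  set (Z := fun i => / cos (INR (K - i) * d)).
  assert (CZ : convex_decreasing K Z).
  { split; [|split].
    - intros i Hi. specialize (J (K - i)%nat ltac:(lia)).
      left. apply Rinv_0_lt_compat, cos_gt_0; lra.
    - intros i Hi. assert (A := J (K - i)%nat ltac:(lia)).
      assert (B := J (K - S i)%nat ltac:(lia)). apply Rinv_le_contravar.
      + apply cos_gt_0; lra.
      + apply cos_decr_1; try lra. apply Rmult_le_compat_r; [lra|]. apply le_INR; lia.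
    - intros i Hi. unfold Z. set (j := (K - S (S i))%nat).
      assert (A := J j ltac:(unfold j; lia)).
      assert (B := J (S (S j)) ltac:(unfold j; lia)). rewrite !S_INR in B.
      replace (K - S i)%nat with (S j) by (unfold j; lia).
      replace (K - i)%nat with (S (S j)) by (unfold j; lia). rewrite !S_INR.
      assert (C := sec_convex ((INR j + 1) * d) d ltac:(lra) ltac:(lra) ltac:(lra)).
      replace ((INR j + 1) * d - d) with (INR j * d) in C by ring.
      replace ((INR j + 1) * d + d) with ((INR j + 1 + 1) * d) in C by ring.
      unfold Rdiv in C. lra. }
  destruct (periodic_multiplier K _ HK
    (cos_mixture_convex K _ HK (convex_decreasing_pow K (2 * m) Z CZ)))
    as [M [M1 [M2 [M3 M4]]]].
  exists (fun k => M (2 * q * k)%nat). split.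
  - intros D. assert (E := M4 D (2 * q)%nat). cbv beta in E.
    unfold Z in E. rewrite Nat.sub_0_r, Kd, pow_inv in E. exact E.
  - intros k Hk. set (j := (2 * q * ((k - K) + (K - k)))%nat) in *.
    assert (E : M (2 * q * k)%nat = M j).
    { destruct (Nat.le_gt_cases K k) as [L|L].
      - replace (2 * q * k)%nat with (2 * K * q + j)%nat; [apply M2|].
        unfold j. replace (K - k)%nat with O by lia.
        rewrite (Nat.mul_comm (2 * K)), Nat.add_0_r. nia.
      - assert (F : (2 * q * k + j = 2 * K * q)%nat).
        { unfold j. replace (k - K)%nat with O by lia. nia. }
        replace (2 * q * k)%nat with (2 * K * q - j)%nat by lia. apply M3. lia. }
    rewrite E, M1 by exact Hk. unfold Z. replace (K - (K - j))%nat with j by lia.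
    assert (A := J j Hk).
    assert (F : sin (INR k * (PI / INR K) / 2) = cos (INR j * d)).
    { unfold j, d. rewrite !mult_INR. simpl (INR 2).
      destruct (Nat.le_gt_cases K k) as [L|L].
      - replace (K - k)%nat with O by lia. rewrite Nat.add_0_r, minus_INR by exact L.
        rewrite cos_sin. f_equal. field. lra.
      - replace (k - K)%nat with O by lia. rewrite Nat.add_0_l, minus_INR by lia.
        rewrite <- sin_shift. f_equal. field. lra. }
    rewrite F, <- Rpow_mult_distr, Rinv_l, pow1; [reflexivity|].
    assert (0 < cos (INR j * d)) by (apply cos_gt_0; lra). lra.
Qed.

Lemma sum_tents (n w I k : nat) : (n <= k <= n + I * w)%nat ->
  sum_f_R0 (fun i => INR (w - (k - (n + i * w)) - ((n + i * w) - k))) I = INR w.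
Proof.
  intros Hk.
  assert (H : ((k <= n + I * w)%nat ->
      sum_f_R0 (fun i => INR (w - (k - (n + i * w)) - ((n + i * w) - k))) I = INR w) /\
    ((n + I * w <= k)%nat ->
      sum_f_R0 (fun i => INR (w - (k - (n + i * w)) - ((n + i * w) - k))) I =
      INR (w - (k - (n + I * w))))).
  { destruct Hk as [Hk _]. induction I as [|I [IH1 IH2]]; cbn [sum_f_R0].
    - split; intros; f_equal; lia.
    - replace (n + S I * w)%nat with (n + I * w + w)%nat by ring.
      set (p := (n + I * w)%nat) in *. split; intros H.
      + destruct (Nat.le_gt_cases k p) as [L|L].
        * rewrite IH1 by exact L.
          replace (w - (k - (p + w)) - (p + w - k))%nat with O by lia. simpl; ring.
        * rewrite IH2 by lia. rewrite <- plus_INR. f_equal. lia.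
      + rewrite IH2 by lia. rewrite <- plus_INR. f_equal. lia. }
  apply H. apply Hk.
Qed.

(** On the support of the tent, [X k * sin^(2m) = 1], so the tent is the product of
    the difference with step [PI / p] and of two multipliers of known norm. *)
Lemma tent_difference_bound (a b : nat -> R) (D m p q w : nat) (psi W : R) (G : nat -> R) :
  (1 <= w <= p)%nat -> (1 <= q)%nat -> (2 * q * (w - 1) <= p)%nat ->
  (forall x, Rabs (tpoly a b D psi
    (fun k => (2 * sin (INR k * (PI / INR p) / 2)) ^ (2 * m) * G k) x) <= W) ->
  forall x, Rabs (tpoly a b D psi (fun k => INR (w - (k - p) - (p - k)) * G k) x) <=
    2 * INR w * / cos (PI / (4 * INR q)) ^ (2 * m) * (/ 4 ^ m * W).
Proof.
  intros Hw Hq Hwq HW x.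
  destruct (cosecant_multiplier p q m ltac:(lia) Hq) as [X [X1 X2]].
  assert (M := multiplier_le_mult D _ _ _ _ (tent_multiplier D w p Hw) (X1 D)).
  rewrite (tpoly_ext _ _ _ _ _ (fun k => INR (w - (k - p) - (p - k)) * X k *
    (/ 4 ^ m * ((2 * sin (INR k * (PI / INR p) / 2)) ^ (2 * m) * G k)))).
  - apply M. intros y. rewrite tpoly_scal, Rabs_mult.
    assert (0 < / 4 ^ m) by (apply Rinv_0_lt_compat, pow_lt; lra).
    rewrite Rabs_pos_eq by lra. apply Rmult_le_compat_l; [lra|apply HW].
  - intros k _. rewrite Rpow_mult_distr, (pow_mult 2). replace (2 ^ 2) with 4 by ring.
    assert (E : INR (w - (k - p) - (p - k)) *
      (X k * sin (INR k * (PI / INR p) / 2) ^ (2 * m)) = INR (w - (k - p) - (p - k))).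
    { destruct (Nat.le_gt_cases w ((k - p) + (p - k))) as [L|L].
      - replace (w - (k - p) - (p - k))%nat with O by lia. simpl; ring.
      - rewrite X2; [ring|]. nia. }
    rewrite <- E at 1. field. apply pow_nonzero. lra.
Qed.

(** The width [w] is about [n / (2 q)], but at least [1]; in both cases
    [28 q w >= 7 n], so [28 q + 1] tents cover [n..8n]. *)
Lemma middle_frequency_bound (a b : nat -> R) (D m n q : nat) (psi W : R) (G : nat -> R) :
  (1 <= n)%nat -> (1 <= q)%nat ->
  (forall t, Rabs t <= PI / INR n -> forall x,
    Rabs (tpoly a b D psi (fun k => (2 * sin (INR k * t / 2)) ^ (2 * m) * G k) x) <= W) ->
  exists R : nat -> R,
    (forall k, (n <= k <= 8 * n)%nat -> R k = 1) /\
    forall x, Rabs (tpoly a b D psi (fun k => R k * G k) x) <=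
      2 * (28 * INR q + 1) * / cos (PI / (4 * INR q)) ^ (2 * m) * (/ 4 ^ m * W).
Proof.
  intros Hn Hq HW. pose proof PI_RGT_0 as pi0.
  assert (n0 : 0 < INR n) by (apply lt_0_INR; lia).
  set (w := max 1 (n / (2 * q))).
  assert (Hqw : (2 * q * (w - 1) <= n)%nat).
  { unfold w. pose proof (Nat.Div0.mul_div_le n (2 * q)).
    destruct (Nat.max_spec 1 (n / (2 * q))) as [[_ ->]|[_ ->]]; nia. }
  assert (Hw1 : (1 <= w)%nat) by (unfold w; lia).
  assert (Hwn : (w <= n)%nat).
  { unfold w. pose proof (Nat.Div0.div_le_upper_bound n (2 * q) n ltac:(nia)). lia. }
  assert (Hcover : (7 * n <= 28 * q * w)%nat).
  { pose proof (Nat.mod_upper_bound n (2 * q) ltac:(lia)).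
    pose proof (Nat.div_mod_eq n (2 * q)). unfold w.
    destruct (Nat.max_spec 1 (n / (2 * q))) as [[H1 ->]|[H1 ->]]; nia. }
  assert (w0 : 0 < INR w) by (apply lt_0_INR; lia).
  set (p := fun i => (n + i * w)%nat).
  exists (fun k => sum_f_R0 (fun i => / INR w * INR (w - (k - p i) - (p i - k))) (28 * q)).
  split.
  - intros k Hk. rewrite sum_scal. unfold p. rewrite sum_tents by lia. field. lra.
  - intros x. set (B := / cos (PI / (4 * INR q)) ^ (2 * m) * (/ 4 ^ m * W)).
    assert (T : forall i, Rabs (tpoly a b D psi
      (fun k => / INR w * (INR (w - (k - p i) - (p i - k)) * G k)) x) <= 2 * B).
    { intros i. rewrite tpoly_scal, Rabs_mult, Rabs_pos_eq
        by (left; apply Rinv_0_lt_compat, w0).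
      replace (2 * B) with (/ INR w * (2 * INR w * B)) by (field; lra).
      apply Rmult_le_compat_l; [left; apply Rinv_0_lt_compat, w0|].
      unfold B. rewrite <- Rmult_assoc.
      apply tent_difference_bound; [unfold p; nia|exact Hq|unfold p; nia|].
      apply HW. assert (pn : INR n <= INR (p i)) by (apply le_INR; unfold p; lia).
      rewrite Rabs_pos_eq by (left; apply Rdiv_lt_0_compat; lra).
      apply Rmult_le_compat_l; [lra|]. apply Rinv_le_contravar; lra. }
    rewrite (tpoly_ext _ _ _ _ _ (fun k => sum_f_R0 (fun i =>
      / INR w * (INR (w - (k - p i) - (p i - k)) * G k)) (28 * q))).
    + assert (S : forall I, Rabs (tpoly a b D psi (fun k => sum_f_R0 (fun i =>
        / INR w * (INR (w - (k - p i) - (p i - k)) * G k)) I) x) <= (INR I + 1) * (2 * B)).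
      { induction I as [|I IH]; cbn [sum_f_R0].
        - simpl (INR 0). rewrite Rplus_0_l, Rmult_1_l. apply T.
        - rewrite tpoly_plus, S_INR. eapply Rle_trans; [apply Rabs_triang|].
          specialize (T (S I)). lra. }
      specialize (S (28 * q)%nat). rewrite mult_INR in S.
      replace (INR 28) with 28 in S by (simpl; ring). unfold B in S. lra.
    + intros k _. rewrite (Rmult_comm _ (G k)), <- sum_scal. apply sum_eq. intros; ring.
Qed.

(** * The Jackson-Stechkin inequality for trigonometric polynomials *)

Lemma bernoulli_le (y : R) (p : nat) : 0 <= y <= 1 -> 1 - INR p * y <= (1 - y) ^ p.
Proof.
  intros Hy. induction p as [|p IH].
  - simpl. lra.
  - rewrite S_INR. simpl pow. pose proof (pos_INR p).
    assert (0 <= (1 - y) * ((1 - y) ^ p - (1 - INR p * y))) by (apply Rmult_le_pos; lra).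
    nra.
Qed.

Lemma cos_lower (x : R) : 0 <= x <= 2 -> 1 - x ^ 2 / 2 <= cos x.
Proof.
  intros Hx. replace (cos x) with (1 - 2 * sin (x / 2) * sin (x / 2))
    by (rewrite <- cos_2a_sin; f_equal; field).
  assert (H : 0 <= sin (x / 2) <= x / 2).
  { destruct (Req_dec x 0) as [->|Hne].
    - replace (0 / 2) with 0 by field. rewrite sin_0. lra.
    - pose proof PI2_3_2. unfold PI2 in *. split.
      + apply sin_ge_0; lra.
      + left. apply sin_lt_x. lra. }
  nra.
Qed.

Lemma sec_pow_le (m q : nat) : (1 <= q)%nat -> (2 * m <= q * q)%nat ->
  / cos (PI / (4 * INR q)) ^ (2 * m) <= 2.
Proof.
  intros Hq Hm. pose proof PI_4. pose proof PI_RGT_0.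
  assert (q0 : 1 <= INR q) by (apply (le_INR 1); lia).
  assert (x1 : 0 <= PI / (4 * INR q) <= / INR q).
  { split; [left; apply Rdiv_lt_0_compat; lra|].
    replace (/ INR q) with (4 / (4 * INR q)) by (field; lra).
    apply Rmult_le_compat_r; [left; apply Rinv_0_lt_compat; lra|lra]. }
  assert (iq : / INR q <= 1) by (rewrite <- Rinv_1; apply Rinv_le_contravar; lra).
  assert (C := cos_lower (PI / (4 * INR q)) ltac:(lra)).
  set (y := / INR q ^ 2 / 2).
  assert (qm : 2 * INR m <= INR q ^ 2).
  { apply le_INR in Hm. rewrite !mult_INR in Hm. simpl (INR 2) in Hm. lra. }
  assert (q2 : 1 <= INR q ^ 2) by nra.
  assert (iq2 : 0 < / INR q ^ 2 <= 1).
  { split; [apply Rinv_0_lt_compat; lra|].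
    rewrite <- Rinv_1. apply Rinv_le_contravar; lra. }
  assert (Cy : 1 - y <= cos (PI / (4 * INR q))).
  { apply Rle_trans with (2 := C). unfold y. rewrite <- pow_inv.
    assert ((PI / (4 * INR q)) ^ 2 <= (/ INR q) ^ 2) by (apply pow_incr; lra). lra. }
  assert (B := bernoulli_le y (2 * m) ltac:(unfold y; lra)).
  assert (H1 : INR (2 * m) * y <= / 2).
  { rewrite mult_INR. simpl (INR 2). unfold y.
    apply Rmult_le_reg_r with (2 * INR q ^ 2); [lra|].
    replace ((1 + 1) * INR m * (/ INR q ^ 2 / 2) * (2 * INR q ^ 2)) with (2 * INR m)
      by (field; lra). lra. }
  assert (H2 : (1 - y) ^ (2 * m) <= cos (PI / (4 * INR q)) ^ (2 * m)).
  { apply pow_incr. unfold y in *. lra. }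
  apply Rle_trans with (/ / 2); [apply Rinv_le_contravar; lra|rewrite Rinv_inv; lra].
Qed.

(** The smallest [q] with [q^2 > 2 m] keeps the secant power at most [2] and is of
    order [sqrt m]. The trapezoid [V] vanishes from [8 n] on and [R] is [1] on
    [n..8n], so that [(1 - R) V] vanishes from [n] on. *)
Lemma jackson_stechkin_even (a b : nat -> R) (D m n : nat) (W : R) :
  (1 <= m)%nat -> (1 <= n)%nat ->
  (forall t, Rabs t <= PI / INR n -> forall x,
    Rabs (fin_diff (2 * m) t (tpoly a b D 0 (fun _ => 1)) x) <= W) ->
  exists H : nat -> R, (forall k, (n <= k)%nat -> H k = 0) /\
    forall x, Rabs (tpoly a b D 0 (fun _ => 1) x - tpoly a b D 0 H x) <=
      900 * sqrt (INR m) / 4 ^ m * W.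
Proof.
  intros Hm Hn HW.
  assert (HW1 : forall t, Rabs t <= PI / INR n -> forall x,
    Rabs (tpoly a b D 0 (fun k => (2 * sin (INR k * t / 2)) ^ (2 * m) * 1) x) <= W).
  { intros t Ht. apply even_fin_diff_multiplier. apply HW, Ht. }
  assert (W0 : 0 <= W).
  { eapply Rle_trans; [apply Rabs_pos|]. apply (HW 0) with (x := 0).
    rewrite Rabs_R0. left. apply Rdiv_lt_0_compat; [apply PI_RGT_0|apply lt_0_INR; lia]. }
  assert (High := high_frequency_bound a b D m n 0 W Hm Hn HW1).
  set (V := trapezoid (4 * n)) in *.
  set (q := S (Nat.sqrt (2 * m))).
  destruct (Nat.sqrt_spec (2 * m) ltac:(lia)) as [Q1 Q2]. fold q in Q2.
  destruct (middle_frequency_bound a b D m n q 0 (3 * W) V Hn ltac:(unfold q; lia))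
    as [R [R1 R2]].
  { intros t Ht x.
    rewrite (tpoly_ext _ _ _ _ _ (fun k => V k * ((2 * sin (INR k * t / 2)) ^ (2 * m) * 1)))
      by (intros; ring).
    apply trapezoid_multiplier; [lia|]. apply HW1, Ht. }
  exists (fun k => (1 - R k) * V k). split.
  - intros k Hk. destruct (Nat.le_gt_cases k (8 * n)) as [L|L].
    + rewrite R1 by lia. ring.
    + unfold V. rewrite trapezoid_high by lia. ring.
  - intros x.
    replace (tpoly a b D 0 (fun _ => 1) x - tpoly a b D 0 (fun k => (1 - R k) * V k) x)
      with (tpoly a b D 0 (fun k => 1 - V k) x + tpoly a b D 0 (fun k => R k * V k) x).
    + eapply Rle_trans; [apply Rabs_triang|].
      specialize (High x). specialize (R2 x).
      assert (S := sec_pow_le m q ltac:(unfold q; lia) ltac:(lia)).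
      assert (Cb := central_binomial_lower m Hm).
      assert (m1 : 1 <= INR m) by (apply (le_INR 1); lia).
      assert (s1 : 1 <= sqrt (INR m)) by (rewrite <- sqrt_1; apply sqrt_le_1_alt, m1).
      assert (s2 := sqrt_sqrt (INR m) ltac:(lra)).
      assert (q1 : INR q <= 5 / 2 * sqrt (INR m)).
      { unfold q. rewrite S_INR.
        assert (INR (Nat.sqrt (2 * m)) <= 3 / 2 * sqrt (INR m)); [|lra].
        apply Rsqr_incr_0_var; [|lra]. unfold Rsqr. rewrite <- mult_INR.
        apply le_INR in Q1. rewrite (mult_INR 2) in Q1. simpl (INR 2) in Q1. nra. }
      assert (F : 0 < / 4 ^ m) by (apply Rinv_0_lt_compat, pow_lt; lra).
      unfold Rdiv in Cb |- *. set (e := / 4 ^ m) in *. set (s := sqrt (INR m)) in *.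
      assert (eW : 0 <= e * W) by (apply Rmult_le_pos; lra).
      assert (T1 : / Binomial.C (2 * m) m * W <= 2 * s * e * W)
        by (apply Rmult_le_compat_r; lra).
      assert (T2 : 2 * (28 * INR q + 1) * / cos (PI / (4 * INR q)) ^ (2 * m) * (e * (3 * W)) <=
        2 * (71 * s) * 2 * (e * (3 * W))).
      { apply Rmult_le_compat_r; [lra|]. pose proof (pos_INR q).
        apply Rmult_le_compat; try lra.
        left. apply Rinv_0_lt_compat, pow_lt. pose proof PI_RGT_0.
        assert (1 <= INR q) by (apply (le_INR 1); unfold q; lia).
        assert (PI / (4 * INR q) <= PI / 4)
          by (apply Rmult_le_compat_l; [lra|]; apply Rinv_le_contravar; lra).
        assert (0 < PI / (4 * INR q)) by (apply Rdiv_lt_0_compat; lra).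
        apply cos_gt_0; lra. }
      assert (0 <= s * (e * W)) by (apply Rmult_le_pos; lra).
      replace (2 * (71 * s) * 2 * (e * (3 * W))) with (852 * (s * (e * W))) in T2 by ring.
      replace (2 * s * e * W) with (2 * (s * (e * W))) in T1 by ring.
      replace (900 * s * e * W) with (900 * (s * (e * W))) by ring. lra.
    + rewrite (tpoly_ext _ _ _ _ (fun k => (1 - R k) * V k) (fun k => V k + (-1) * (R k * V k)))
        by (intros; ring).
      rewrite (tpoly_ext _ _ _ _ (fun k => 1 - V k) (fun k => 1 + (-1) * V k)) by (intros; ring).
      rewrite !tpoly_plus, !tpoly_scal. ring.
Qed.

Lemma jackson_stechkin (a b : nat -> R) (D r n : nat) (W : R) :
  (1 <= r)%nat -> (1 <= n)%nat ->
  (forall t, Rabs t <= PI / INR n -> forall x,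
    Rabs (fin_diff r t (tpoly a b D 0 (fun _ => 1)) x) <= W) ->
  exists H : nat -> R, (forall k, (n <= k)%nat -> H k = 0) /\
    forall x, Rabs (tpoly a b D 0 (fun _ => 1) x - tpoly a b D 0 H x) <=
      900 * sqrt (INR r) / 2 ^ r * W.
Proof.
  intros Hr Hn HW.
  assert (W0 : 0 <= W).
  { eapply Rle_trans; [apply Rabs_pos|]. apply (HW 0) with (x := 0).
    rewrite Rabs_R0. left. apply Rdiv_lt_0_compat; [apply PI_RGT_0|apply lt_0_INR; lia]. }
  destruct (Nat.Even_or_Odd r) as [[m Em]|[m Em]].
  - subst r. destruct (jackson_stechkin_even a b D m n W) as [H [H1 H2]]; [lia|lia|exact HW|].
    exists H. split; [exact H1|]. intros x. apply Rle_trans with (1 := H2 x).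
    rewrite pow_mult. replace (2 ^ 2) with 4 by ring.
    apply Rmult_le_compat_r; [exact W0|]. apply Rmult_le_compat_r.
    + left. apply Rinv_0_lt_compat, pow_lt. lra.
    + apply Rmult_le_compat_l; [lra|]. apply sqrt_le_1_alt, le_INR. lia.
  - destruct (jackson_stechkin_even a b D (S m) n (2 * W)) as [H [H1 H2]]; [lia|lia| |].
    + intros t Ht x. replace (2 * S m)%nat with (S r) by lia. rewrite fin_diff_S.
      eapply Rle_trans; [apply Rabs_triang|]. rewrite Rabs_Ropp.
      assert (A := HW t Ht x). assert (B := HW t Ht (x + t)). lra.
    + exists H. split; [exact H1|]. intros x. apply Rle_trans with (1 := H2 x).
      replace (4 ^ S m) with (2 * 2 ^ r).
      * assert (0 < 2 ^ r) by (apply pow_lt; lra).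
        replace (900 * sqrt (INR (S m)) / (2 * 2 ^ r) * (2 * W))
          with (900 * sqrt (INR (S m)) / 2 ^ r * W) by (field; lra).
        apply Rmult_le_compat_r; [exact W0|]. apply Rmult_le_compat_r.
        -- left. apply Rinv_0_lt_compat. lra.
        -- apply Rmult_le_compat_l; [lra|]. apply sqrt_le_1_alt, le_INR. lia.
      * change (2 * 2 ^ r) with (2 ^ S r). replace (S r) with (2 * S m)%nat by lia.
        rewrite pow_mult. f_equal. ring.
Qed.

(** * Density of trigonometric polynomials *)

Definition is_tpoly (f : R -> R) : Prop :=
  exists a b D, forall x, f x = tpoly a b D 0 (fun _ => 1) x.

Lemma tpoly_pad (a b : nat -> R) (D E : nat) (x : R) : (D <= E)%nat ->
  tpoly a b D 0 (fun _ => 1) x =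
  tpoly (fun k => if le_dec k D then a k else 0) (fun k => if le_dec k D then b k else 0)
    E 0 (fun _ => 1) x.
Proof.
  intros H. induction H as [|E H IH].
  - unfold tpoly. apply sum_eq. intros k Hk. destruct (le_dec k D); [reflexivity|lia].
  - unfold tpoly in *. rewrite tech5, <- IH.
    destruct (le_dec (S E) D); [lia|]. ring.
Qed.

Lemma is_tpoly_plus (f g : R -> R) :
  is_tpoly f -> is_tpoly g -> is_tpoly (fun x => f x + g x).
Proof.
  intros [a [b [D Hf]]] [a' [b' [D' Hg]]].
  exists (fun k => (if le_dec k D then a k else 0) + (if le_dec k D' then a' k else 0)),
    (fun k => (if le_dec k D then b k else 0) + (if le_dec k D' then b' k else 0)), (max D D').
  intros x. rewrite Hf, Hg, (tpoly_pad a b D (max D D')), (tpoly_pad a' b' D' (max D D')) by lia.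
  unfold tpoly. rewrite <- plus_sum. apply sum_eq. intros; ring.
Qed.

Lemma is_tpoly_scal (c : R) (f : R -> R) : is_tpoly f -> is_tpoly (fun x => c * f x).
Proof.
  intros [a [b [D H]]]. exists (fun k => c * a k), (fun k => c * b k), D.
  intros x. rewrite H. unfold tpoly. rewrite <- sum_scal. apply sum_eq. intros; ring.
Qed.

Lemma is_tpoly_sum (f : nat -> R -> R) (N : nat) :
  (forall l, is_tpoly (f l)) -> is_tpoly (fun x => sum_f_R0 (fun l => f l x) N).
Proof.
  intros H. induction N as [|N IH]; cbn [sum_f_R0]; [apply H|].
  apply is_tpoly_plus; auto.
Qed.

Lemma is_tpoly_cos (k : nat) (y : R) : is_tpoly (fun x => cos (INR k * (x - y))).
Proof.
  exists (fun i => if Nat.eq_dec i k then cos (INR k * y) else 0),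
    (fun i => if Nat.eq_dec i k then sin (INR k * y) else 0), k.
  intros x. rewrite Rmult_minus_distr_l, cos_minus. unfold tpoly.
  rewrite <- (sum_single k k (cos (INR k * x) * cos (INR k * y) + sin (INR k * x) * sin (INR k * y)))
    by lia.
  apply sum_eq. intros i _. rewrite Rplus_0_r. destruct (Nat.eq_dec i k) as [->|]; ring.
Qed.

Lemma is_tpoly_fejer (p : nat) (y : R) : is_tpoly (fun x => fejer p (x - y)).
Proof.
  assert (H1 : is_tpoly (fun _ => 1)).
  { destruct (is_tpoly_cos 0 0) as [a [b [D H]]]. exists a, b, D. intros x. rewrite <- H.
    simpl. rewrite Rmult_0_l, cos_0. reflexivity. }
  assert (HD : forall q, is_tpoly (fun x => dirichlet q (x - y))).
  { induction q as [|q IH]; [exact H1|].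
    apply (is_tpoly_plus (fun x => dirichlet q (x - y))
      (fun x => 2 * cos (INR (S q) * (x - y)))); [exact IH|].
    apply (is_tpoly_scal 2 (fun x => cos (INR (S q) * (x - y)))), is_tpoly_cos. }
  induction p as [|p IH]; simpl fejer.
  - destruct (is_tpoly_scal 0 _ H1) as [a [b [D H]]]. exists a, b, D. intros x.
    rewrite <- H. ring.
  - apply is_tpoly_plus; [exact IH|apply HD].
Qed.

Lemma node_sum_fejer_shift (K : nat) (x : R) : (1 <= K)%nat ->
  node_sum K (fun s => fejer K (x - s)) = 2 * INR K * INR K.
Proof.
  intros HK.
  assert (HD : forall q, (q < K)%nat -> node_sum K (fun s => dirichlet q (x - s)) = 2 * INR K).
  { induction q as [|q IH]; intros Hq.
    - apply node_sum_one, HK.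
    - rewrite (node_sum_ext _ _ (fun s => dirichlet q (x - s) +
        (cos (INR (S q) * s + - (INR (S q) * x)) + cos (INR (S q) * s + - (INR (S q) * x))))).
      + rewrite !node_sum_plus, IH, node_sum_cos_phase by lia. ring.
      + intros s.
        change (dirichlet (S q) (x - s)) with (dirichlet q (x - s) + 2 * cos (INR (S q) * (x - s))).
        replace (INR (S q) * s + - (INR (S q) * x)) with (- (INR (S q) * (x - s))) by ring.
        rewrite cos_neg. ring. }
  assert (HF : forall p, (p <= K)%nat ->
    node_sum K (fun s => fejer p (x - s)) = 2 * INR K * INR p).
  { induction p as [|p IH]; intros Hp.
    - unfold node_sum. simpl fejer. rewrite sum_cte. simpl INR. ring.
    - rewrite (node_sum_ext _ _ (fun s => fejer p (x - s) + dirichlet p (x - s)))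
        by reflexivity.
      rewrite node_sum_plus, IH, HD, S_INR by lia. ring. }
  apply HF. lia.
Qed.

Lemma periodic_Z (f : R -> R) (z : Z) (x : R) : periodic f -> f (x + 2 * PI * IZR z) = f x.
Proof.
  intros P.
  assert (N : forall k y, f (y + 2 * PI * INR k) = f y).
  { induction k as [|k IH]; intros y.
    - simpl INR. f_equal. ring.
    - rewrite S_INR. replace (y + 2 * PI * (INR k + 1)) with (y + 2 * PI * INR k + 2 * PI) by ring.
      rewrite P. apply IH. }
  destruct (Z.le_gt_cases 0 z) as [L|L].
  - rewrite <- (Z2Nat.id z L), <- INR_IZR_INZ. apply N.
  - rewrite <- (N (Z.to_nat (- z)) (x + 2 * PI * IZR z)). f_equal.
    rewrite INR_IZR_INZ, Z2Nat.id, opp_IZR by lia. ring.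
Qed.

Lemma reduce_mod_2PI (x : R) : exists z : Z, 0 <= x + 2 * PI * IZR z <= 2 * PI.
Proof.
  pose proof PI_RGT_0. exists (- Int_part (x / (2 * PI)))%Z. rewrite opp_IZR.
  destruct (base_Int_part (x / (2 * PI))) as [A B].
  replace (x + 2 * PI * - IZR (Int_part (x / (2 * PI))))
    with (2 * PI * (x / (2 * PI) - IZR (Int_part (x / (2 * PI))))) by (field; lra).
  split; [apply Rmult_le_pos; lra|].
  apply Rle_trans with (2 * PI * 1); [apply Rmult_le_compat_l; lra|lra].
Qed.

Lemma periodic_bounded (f : R -> R) : (forall x, continuous f x) -> periodic f ->
  exists B, 0 <= B /\ forall x, Rabs (f x) <= B.
Proof.
  intros Cf P. pose proof PI_RGT_0.
  assert (Cp : forall c, 0 <= c <= 2 * PI -> continuity_pt f c)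
    by (intros; apply continuity_pt_filterlim, Cf).
  destruct (continuity_ab_maj f 0 (2 * PI) ltac:(lra) Cp) as [M [HM _]].
  destruct (continuity_ab_min f 0 (2 * PI) ltac:(lra) Cp) as [m [Hm _]].
  exists (Rabs (f M) + Rabs (f m)). split.
  - pose proof (Rabs_pos (f M)). pose proof (Rabs_pos (f m)). lra.
  - intros x. destruct (reduce_mod_2PI x) as [z Hz]. rewrite <- (periodic_Z f z x P).
    specialize (HM _ Hz). specialize (Hm _ Hz). apply Rabs_le.
    pose proof (Rle_abs (f M)). pose proof (Rle_abs (- f m)). rewrite Rabs_Ropp in *.
    pose proof (Rabs_pos (f M)). pose proof (Rabs_pos (f m)). lra.
Qed.

(** Uniform continuity controls nearby points of the circle; at the others
    [1 - cos (x - y)] is bounded below, and the boundedness of [f] suffices. *)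
Lemma periodic_modulus (f : R -> R) (e : R) :
  (forall x, continuous f x) -> periodic f -> 0 < e ->
  exists M, 0 <= M /\ forall x y, Rabs (f x - f y) <= e + M * (1 - cos (x - y)).
Proof.
  intros Cf P He. pose proof PI_RGT_0.
  destruct (periodic_bounded f Cf P) as [B [B0 HB]].
  destruct (Heine f (fun c => - PI <= c <= 3 * PI) (compact_P3 _ _)
    (fun c _ => proj2 (continuity_pt_filterlim f c) (Cf c)) (mkposreal e He)) as [d Hd].
  simpl in Hd. set (d' := Rmin d PI).
  assert (d0 : 0 < d' <= PI) by (unfold d'; pose proof (cond_pos d); split;
    [apply Rmin_glb_lt; lra|apply Rmin_r]).
  assert (cd : cos d' < 1) by (rewrite <- cos_0; apply cos_decreasing_1; lra).
  exists (2 * B / (1 - cos d')).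
  assert (M0 : 0 <= 2 * B / (1 - cos d')) by (apply Rdiv_le_0_compat; lra).
  split; [exact M0|]. intros x y.
  destruct (reduce_mod_2PI x) as [z Hz]. set (x0 := x + 2 * PI * IZR z) in *.
  destruct (reduce_mod_2PI (y - x0 + PI)) as [z' Hz'].
  set (y0 := y + 2 * PI * IZR z').
  assert (Hy0 : - PI <= y0 - x0 <= PI) by (unfold y0; lra).
  rewrite <- (periodic_Z f z x P), <- (periodic_Z f z' y P). fold x0 y0.
  assert (Pc : periodic cos).
  { intros u. replace (u + 2 * PI) with (u + 2 * INR 1 * PI) by (simpl; ring). apply cos_period. }
  assert (Ec : cos (x - y) = cos (Rabs (y0 - x0))).
  { rewrite <- (periodic_Z cos (z - z') (x - y) Pc), minus_IZR.
    replace (x - y + 2 * PI * (IZR z - IZR z')) with (- (y0 - x0)) by (unfold x0, y0; ring).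
    rewrite cos_neg. unfold Rabs. destruct (Rcase_abs (y0 - x0)); [rewrite cos_neg|]; reflexivity. }
  rewrite Ec. set (u := Rabs (y0 - x0)).
  assert (Hu : 0 <= u <= PI) by (unfold u; split; [apply Rabs_pos|apply Rabs_le; lra]).
  assert (cu := COS_bound u).
  destruct (Rlt_le_dec u d') as [L|L].
  - assert (Rabs (f x0 - f y0) < e).
    { apply Hd; try lra. rewrite Rabs_minus_sym. fold u.
      apply Rlt_le_trans with (1 := L). apply Rmin_l. }
    assert (0 <= 2 * B / (1 - cos d') * (1 - cos u)) by (apply Rmult_le_pos; lra). lra.
  - assert (Rabs (f x0 - f y0) <= 2 * B).
    { eapply Rle_trans; [apply Rabs_triang|]. rewrite Rabs_Ropp.
      pose proof (HB x0). pose proof (HB y0). lra. }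
    assert (cos u <= cos d') by (apply cos_decr_1; lra).
    assert (2 * B / (1 - cos d') * (1 - cos d') <= 2 * B / (1 - cos d') * (1 - cos u))
      by (apply Rmult_le_compat_l; lra).
    replace (2 * B / (1 - cos d') * (1 - cos d')) with (2 * B) in H2 by (field; lra). lra.
Qed.

(** The approximation is the discrete Fejer mean. Its error is the mean of
    [|f x - f y|] against the kernel, and the term [1 - cos] of
    [periodic_modulus] cancels the denominator of the kernel, leaving
    [2 M / K]. *)
Lemma tpoly_dense (f : R -> R) (e : R) :
  (forall x, continuous f x) -> periodic f -> 0 < e ->
  exists a b D, forall x, Rabs (f x - tpoly a b D 0 (fun _ => 1) x) <= e.
Proof.
  intros Cf P He.
  destruct (periodic_modulus f (e / 2) Cf P ltac:(lra)) as [M [M0 HM]].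
  destruct (INR_unbounded (4 * M / e)) as [K HK].
  assert (K0 : 0 < INR K).
  { apply Rle_lt_trans with (2 := HK). apply Rdiv_le_0_compat; lra. }
  assert (K1 : (1 <= K)%nat) by (apply INR_lt; exact K0).
  set (c := / (2 * INR K * INR K)).
  assert (c0 : 0 < c) by (apply Rinv_0_lt_compat; nra).
  assert (T : is_tpoly (fun x => c * sum_f_R0 (fun l =>
    f (node K l) * fejer K (x - node K l)) (2 * K - 1))).
  { apply (is_tpoly_scal c (fun x => sum_f_R0 (fun l =>
      f (node K l) * fejer K (x - node K l)) (2 * K - 1))).
    apply (is_tpoly_sum (fun l x => f (node K l) * fejer K (x - node K l))).
    intros l. apply (is_tpoly_scal _ (fun x => fejer K (x - node K l))), is_tpoly_fejer. }
  destruct T as [a [b [D T]]]. exists a, b, D. intros x. rewrite <- T.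
  assert (N := node_sum_fejer_shift K x K1). unfold node_sum in N.
  replace (f x) with (c * sum_f_R0 (fun l => f x * fejer K (x - node K l)) (2 * K - 1))
    by (rewrite sum_scal, N; unfold c; field; lra).
  rewrite <- Rmult_minus_distr_l, <- minus_sum, Rabs_mult, (Rabs_pos_eq c) by lra.
  apply Rle_trans with (c * sum_f_R0 (fun l => e / 2 * fejer K (x - node K l) + 2 * M) (2 * K - 1)).
  - apply Rmult_le_compat_l; [lra|]. eapply Rle_trans; [apply Rsum_abs|].
    apply sum_Rle. intros l _. set (s := x - node K l).
    rewrite <- Rmult_minus_distr_r, Rabs_mult, (Rabs_pos_eq (fejer K s)) by apply fejer_nonneg.
    assert (F := fejer_nonneg K s). assert (H := HM x (node K l)). fold s in H.
    assert (E : fejer K s * (1 - cos s) <= 2).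
    { replace (1 - cos s) with (2 * sin (s / 2) ^ 2).
      - assert (FS := fejer_sin K s). assert (SB := SIN_bound (INR K * (s / 2))). nra.
      - replace s with (2 * (s / 2)) at 2 by field. rewrite cos_2a_sin. ring. }
    apply Rle_trans with ((e / 2 + M * (1 - cos s)) * fejer K s);
      [apply Rmult_le_compat_r; lra|]. nra.
  - rewrite plus_sum, sum_scal, N, sum_cte.
    replace (S (2 * K - 1)) with (2 * K)%nat by lia. rewrite mult_INR. simpl (INR 2).
    replace (c * (e / 2 * (2 * INR K * INR K) + 2 * M * ((1 + 1) * INR K)))
      with (e / 2 + 2 * M / INR K) by (unfold c; field; lra).
    assert (2 * M / INR K <= e / 2); [|lra].
    apply Rmult_le_reg_r with (INR K); [lra|].
    replace (2 * M / INR K * INR K) with (2 * M) by (field; lra).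
    assert (4 * M / e * e <= INR K * e) by (apply Rmult_le_compat_r; lra).
    replace (4 * M / e * e) with (4 * M) in H by (field; lra). lra.
Qed.

(** * Favard operators *)

(** Going from [N] to [N + 1] adds the two terms [1 / (4 N + 3)^2] and
    [1 / (4 N + 5)^2], together at most [1 / (N + 1) - 1 / (N + 2)]. *)
Lemma sum_inv_sq_progression_le (N : nat) :
  sum_f_R0 (fun i => / (4 * (INR i - INR N) + 1) ^ 2) (2 * N) <= 2 - / (INR N + 1).
Proof.
  induction N as [|N IH].
  - simpl. lra.
  - replace (2 * S N)%nat with (S (S (2 * N))) by lia.
    rewrite decomp_sum by lia. cbn [pred]. rewrite tech5.
    rewrite (sum_eq _ (fun i => / (4 * (INR i - INR N) + 1) ^ 2)).
    + pose proof (pos_INR N) as n0. rewrite !S_INR, mult_INR. simpl (INR 0). simpl (INR 2).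
      set (x := INR N) in *.
      replace (4 * (0 - (x + 1)) + 1) with (- (4 * x + 3)) by ring.
      replace (4 * ((1 + 1) * x + 1 + 1 - (x + 1)) + 1) with (4 * x + 5) by ring.
      replace ((- (4 * x + 3)) ^ 2) with ((4 * x + 3) ^ 2) by ring.
      assert (E : / (x + 1) - / (x + 1 + 1) = / ((x + 1) * (x + 2))) by (field; lra).
      assert (H1 : / (4 * x + 3) ^ 2 <= / (2 * ((x + 1) * (x + 2))))
        by (apply Rinv_le_contravar; nra).
      assert (H2 : / (4 * x + 5) ^ 2 <= / (2 * ((x + 1) * (x + 2))))
        by (apply Rinv_le_contravar; nra).
      assert (E2 : / (2 * ((x + 1) * (x + 2))) = / ((x + 1) * (x + 2)) / 2) by (field; lra).
      lra.
    + intros i _. rewrite !S_INR. f_equal. f_equal. ring.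
Qed.

Lemma favard_const_le (r : nat) : (1 <= r)%nat -> favard_const r <= 3.
Proof.
  intros Hr. unfold favard_const.
  set (u := fun N => sum_f_R0 (fun i => / (4 * (INR i - INR N) + 1) ^ S r) (2 * N)).
  assert (B : forall N, - 2 <= u N <= 2).
  { intros N. apply Rabs_le_between. unfold u. eapply Rle_trans; [apply Rsum_abs|].
    apply Rle_trans with (sum_f_R0 (fun i => / (4 * (INR i - INR N) + 1) ^ 2) (2 * N)).
    - apply sum_Rle. intros i _. set (y := 4 * (INR i - INR N) + 1).
      assert (Hy : 1 <= Rabs y).
      { unfold y. rewrite !INR_IZR_INZ, <- minus_IZR, <- mult_IZR, <- plus_IZR, <- abs_IZR.
        apply IZR_le. lia. }
      rewrite <- (pow2_abs y), Rabs_inv, <- RPow_abs.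
      apply Rinv_le_contravar; [apply pow_lt; lra|]. apply Rle_pow; [lra|lia].
    - pose proof (sum_inv_sq_progression_le N). pose proof (pos_INR N).
      assert (0 < / (INR N + 1)) by (apply Rinv_0_lt_compat; lra). lra. }
  assert (U : Rbar_le (Lim_seq u) 2).
  { rewrite <- (Lim_seq_const 2). apply Lim_seq_le_loc. exists O. intros N _. apply B. }
  assert (L : Rbar_le (-2) (Lim_seq u)).
  { rewrite <- (Lim_seq_const (-2)). apply Lim_seq_le_loc. exists O. intros N _. apply B. }
  destruct (Lim_seq u) as [l| |]; simpl in *; try contradiction.
  pose proof PI2_3_2 as HPI. unfold PI2 in HPI.
  apply Rmult_le_reg_r with PI; [lra|].
  replace (4 / PI * l * PI) with (4 * l) by (field; lra). lra.
Qed.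

Lemma sup_norm_le (f : R -> R) (B : R) :
  (forall x, Rabs (f x) <= B) <-> Rbar_le (sup_norm f) B.
Proof.
  unfold sup_norm. destruct (Lub_Rbar_correct (fun y => exists x, y = Rabs (f x))) as [U L].
  split.
  - intros H. apply L. intros y [x ->]. apply H.
  - intros H x. assert (A := U (Rabs (f x)) (ex_intro _ x eq_refl)).
    exact (Rbar_le_trans _ _ _ A H).
Qed.

Lemma sup_norm_finite (f : R -> R) (B : R) : (forall x, Rabs (f x) <= B) ->
  exists s, sup_norm f = Finite s /\ 0 <= s <= B.
Proof.
  intros H. assert (U := proj1 (sup_norm_le f B) H).
  assert (L : Rbar_le (Rabs (f 0)) (sup_norm f)).
  { apply (proj1 (Lub_Rbar_correct (fun y => exists x, y = Rabs (f x)))).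
    exists 0. reflexivity. }
  destruct (sup_norm f) as [s| |]; simpl in *; try contradiction.
  exists s. pose proof (Rabs_pos (f 0)). split; [reflexivity|lra].
Qed.

Lemma modulus_ge (r : nat) (f : R -> R) (d t x : R) : Rabs t <= d ->
  Rbar_le (Rabs (fin_diff r t f x)) (modulus r f d).
Proof.
  intros Ht. apply (proj1 (Lub_Rbar_correct _)). exists t, x. split; [exact Ht|reflexivity].
Qed.

Lemma tpoly_periodic (a b : nat -> R) (D : nat) (psi : R) (G : nat -> R) :
  periodic (tpoly a b D psi G).
Proof.
  intros x. apply sum_eq. intros k _.
  replace (INR k * (x + 2 * PI) + psi) with (INR k * x + psi + 2 * INR k * PI) by ring.
  rewrite cos_period, sin_period. reflexivity.
Qed.

Lemma favard_error (n r : nat) (A : favard_operator n r (favard_const r)) (g : R -> R) (B : R) :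
  (1 <= r)%nat -> (1 <= n)%nat -> bounded_derivative_class r g ->
  (forall x, Rabs (Derive_n g r x) <= B) ->
  forall x, Rabs (g x - fav_op A g x) <= 3 * / INR n ^ r * B.
Proof.
  intros Hr Hn Hg HB. destruct (sup_norm_finite _ B HB) as [s [Es Hs]].
  assert (n0 : 0 < / INR n ^ r) by (apply Rinv_0_lt_compat, pow_lt, lt_0_INR; lia).
  apply sup_norm_le. apply Rbar_le_trans with (1 := fav_bound _ _ _ A g Hg).
  rewrite Es. simpl. pose proof (favard_const_le r Hr).
  apply Rle_trans with (3 * / INR n ^ r * s).
  - apply Rmult_le_compat_r; [lra|]. apply Rmult_le_compat_r; lra.
  - apply Rmult_le_compat_l; [nra|lra].
Qed.

Lemma best_approx_le (n r : nat) (A : favard_operator n r (favard_const r)) (f g : R -> R) (B : R) :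
  fav_dom A g -> (forall x, Rabs (f x - fav_op A g x) <= B) -> Rbar_le (best_approx A f) B.
Proof.
  intros Hg HB. destruct (sup_norm_finite (fun x => f x - fav_op A g x) B HB) as [s [Es Hs]].
  apply Rbar_le_trans with s; [|simpl; lra].
  apply (proj1 (Glb_Rbar_correct _)). exists g. split; [exact Hg|exact Es].
Qed.

(** The error splits as [f - T], [T - g], [g - A g] with [T] a trigonometric
    polynomial within [e] of [f] and [g] its truncation to degree [< n]. The last
    part costs [3 (2^(-r) + beta)] times the modulus of [T], and
    [2^(-r) <= beta]. *)
Lemma favard_jackson_stechkin (n r : nat) (A : favard_operator n r (favard_const r))
    (f : R -> R) (W : R) :
  (1 <= r)%nat -> (1 <= n)%nat -> (forall x, continuous f x) -> periodic f ->
  (forall t x, Rabs t <= PI / INR n -> Rabs (fin_diff r t f x) <= W) ->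
  Rbar_le (best_approx A f) (6300 * sqrt (INR r) / 2 ^ r * W).
Proof.
  intros Hr Hn Cf Pf HW.
  assert (n1 : 0 < INR n) by (apply lt_0_INR; lia).
  assert (r1 : 1 <= INR r) by (apply (le_INR 1); lia).
  assert (s1 : 1 <= sqrt (INR r)) by (rewrite <- sqrt_1; apply sqrt_le_1_alt, r1).
  assert (p2 : 0 < 2 ^ r) by (apply pow_lt; lra).
  assert (i2 : 0 < / 2 ^ r) by (apply Rinv_0_lt_compat, p2).
  assert (pn : 0 < PI / INR n) by (apply Rdiv_lt_0_compat; [apply PI_RGT_0|exact n1]).
  set (beta := 900 * sqrt (INR r) / 2 ^ r).
  assert (beta1 : / 2 ^ r <= beta) by (unfold beta, Rdiv; nra).
  assert (beta2 : 2 ^ r * / 2 ^ r = 1) by (field; lra).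
  assert (Main : forall e, 0 < e ->
    Rbar_le (best_approx A f) (e + 7 * beta * (W + 2 ^ r * e))).
  { intros e He. destruct (tpoly_dense f e Cf Pf He) as [a [b [D Hd]]].
    set (T := tpoly a b D 0 (fun _ => 1)) in *. set (W' := W + 2 ^ r * e).
    assert (HT : forall t, Rabs t <= PI / INR n -> forall x, Rabs (fin_diff r t T x) <= W').
    { intros t Ht x. assert (E1 := HW t x Ht). assert (E2 := fin_diff_minus_le r t f T e Hd x).
      rewrite Rabs_minus_sym in E2. unfold W'.
      replace (fin_diff r t T x)
        with (fin_diff r t f x + (fin_diff r t T x - fin_diff r t f x)) by ring.
      eapply Rle_trans; [apply Rabs_triang|]. lra. }
    assert (W0 : 0 <= W').
    { eapply Rle_trans; [apply Rabs_pos|]. apply (HT 0) with (x := 0). rewrite Rabs_R0. lra. }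
    destruct (jackson_stechkin a b D r n W' Hr Hn HT) as [H [H0 HH]].
    fold T beta in HH. set (g := tpoly a b D 0 H) in *.
    assert (Hg : forall x, Rabs (Derive_n g r x) <=
      (INR n / 2) ^ r * (W' + 2 ^ r * (beta * W'))).
    { apply (bernstein_nikolskii_stechkin a b D n r 0 H); [exact Hn|exact Hr| |].
      - intros k Hk. apply H0. lia.
      - intros x. fold g.
        assert (E1 := HT (PI / INR n) ltac:(rewrite Rabs_pos_eq; lra) x).
        assert (E2 := fin_diff_minus_le r (PI / INR n) T g _ HH x).
        rewrite Rabs_minus_sym in E2.
        replace (fin_diff r (PI / INR n) g x) with (fin_diff r (PI / INR n) T x +
          (fin_diff r (PI / INR n) g x - fin_diff r (PI / INR n) T x)) by ring.
        eapply Rle_trans; [apply Rabs_triang|]. lra. }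
    assert (Cg : bounded_derivative_class r g).
    { split; [apply tpoly_periodic|split].
      - intros k x _. apply ex_derive_n_tpoly.
      - eexists. exact Hg. }
    assert (Fg := favard_error n r A g _ Hr Hn Cg Hg).
    apply best_approx_le with g; [apply fav_dom_class, Cg|].
    intros x. specialize (Hd x). specialize (HH x). specialize (Fg x).
    replace (f x - fav_op A g x) with ((f x - T x) + ((T x - g x) + (g x - fav_op A g x))) by ring.
    eapply Rle_trans; [apply Rabs_triang|].
    assert (Tr := Rabs_triang (T x - g x) (g x - fav_op A g x)).
    unfold Rdiv in Fg. rewrite Rpow_mult_distr, pow_inv in Fg.
    replace (3 * / INR n ^ r * (INR n ^ r * / 2 ^ r * (W' + 2 ^ r * (beta * W'))))
      with (3 * (/ 2 ^ r * W') + 3 * (beta * W')) in Fg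
      by (field; split; [lra|apply pow_nonzero; lra]).
    assert (/ 2 ^ r * W' <= beta * W') by (apply Rmult_le_compat_r; lra).
    lra. }
  assert (B0 : 0 <= beta) by lra.
  replace (6300 * sqrt (INR r) / 2 ^ r * W) with (7 * beta * W) by (unfold beta; field; lra).
  assert (P : 0 < 1 + 7 * beta * 2 ^ r) by nra.
  destruct (best_approx A f) as [E| |]; [|exact (Main 1 Rlt_0_1)|exact I].
  simpl in *. apply Rle_plus_epsilon. intros eps He.
  assert (e0 : 0 < eps / (1 + 7 * beta * 2 ^ r)) by (apply Rdiv_lt_0_compat; lra).
  specialize (Main _ e0). set (e := eps / (1 + 7 * beta * 2 ^ r)) in *.
  replace eps with (e * (1 + 7 * beta * 2 ^ r)) by (unfold e; field; lra). lra.
Qed.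

Theorem theorem2 :
  exists c : R, 0 < c /\
    forall (r n : nat), (0 < r)%nat -> (0 < n)%nat ->
    forall (A : favard_operator n r (favard_const r)) (f : R -> R),
      (forall x, continuous f x) -> periodic f ->
      (forall alpha : R, 1 < alpha < 2 * INR n / INR r ->
         Rbar_le (best_approx A f)
           (Rbar_mult
              (c * Rmax (/ (alpha - 1) ^ 2) 1 * sqrt (INR r) * / 2 ^ r)
              (modulus r f (alpha * PI / INR n))))
      /\
      Rbar_le (best_approx A f)
        (Rbar_mult
           (c * Rpower (INR r) (3 / 2) * / 2 ^ r)
           (modulus r f (PI / INR n))).
Proof.
  exists 6300. split; [lra|]. intros r n Hr Hn A f Cf Pf.
  assert (n1 : 0 < INR n) by (apply lt_0_INR; lia).
  assert (r1 : 1 <= INR r) by (apply (le_INR 1); lia).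
  assert (s1 : 1 <= sqrt (INR r)) by (rewrite <- sqrt_1; apply sqrt_le_1_alt, r1).
  assert (i2 : 0 < / 2 ^ r) by (apply Rinv_0_lt_compat, pow_lt; lra).
  assert (pn : 0 < PI / INR n) by (apply Rdiv_lt_0_compat; [apply PI_RGT_0|exact n1]).
  assert (Key : forall d C, PI / INR n <= d -> sqrt (INR r) <= C ->
    Rbar_le (best_approx A f) (Rbar_mult (6300 * C * / 2 ^ r) (modulus r f d))).
  { intros d C Hd HC.
    assert (C0 : 0 < 6300 * C * / 2 ^ r) by (apply Rmult_lt_0_compat; lra).
    assert (Hm : forall t x, Rabs t <= PI / INR n ->
      Rbar_le (Rabs (fin_diff r t f x)) (modulus r f d))
      by (intros; apply modulus_ge; lra).
    destruct (modulus r f d) as [W| |].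
    - apply Rbar_le_trans with (1 := favard_jackson_stechkin n r A f W Hr Hn Cf Pf Hm).
      simpl. assert (0 <= W).
      { eapply Rle_trans; [apply Rabs_pos|]. apply (Hm 0 0). rewrite Rabs_R0. lra. }
      apply Rmult_le_compat_r; [assumption|]. apply Rmult_le_compat_r; lra.
    - rewrite Rbar_mult_comm, (is_Rbar_mult_unique _ _ _ (is_Rbar_mult_p_infty_pos (Finite _) C0)).
      destruct (best_approx A f); exact I.
    - destruct (Hm 0 0). rewrite Rabs_R0. lra. }
  split.
  - intros alpha Ha.
    rewrite (Rmult_assoc 6300). apply Key.
    + unfold Rdiv in *. rewrite Rmult_assoc. nra.
    + assert (M := Rmax_r (/ (alpha - 1) ^ 2) 1). nra.
  - apply Key; [lra|]. rewrite <- Rpower_sqrt by lra. apply Rle_Rpower; lra.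
Qed.
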